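(* Let $k\in\mathbb{N}$ and $\delta\in\mathbb{R}$ with $\delta\notin\mathfrak{C}_k=\{-p/(2(n+1)):p=0,1,\dots,2k-2\}$. Then the Casimir operator $C^k_\delta$ of the Lie algebra $\mathrm{sp}_{2n+2}$ of infinitesimal projective contact transformations, with respect to its Killing form, and for its canonical action on $R^k_\delta=\mathcal{S}^k_{\delta+\frac{k}{n+1}}(\mathbb{R}^{2n+1})$, is given by $$C^k_\delta=\frac1{n+2}\big(c(k,\delta)\,\mathrm{id}+X\circ i_\alpha\big),$$ where $$c(k,\delta)=(n+1)^2\delta^2-(n+1)^2\delta+k(n+1)\delta+\frac{k^2-k}{2}.$$
   Context: Let $n\ge1$, $(p_1,\dots,p_n,q^1,\dots,q^n,t)$ the canonical coordinates of $\mathbb{R}^{2n+1}$, $\alpha=\frac12(\sum_k(p_kdq^k-q^kdp_k)-dt)$ the standard contact form, and $\mathcal{E}_s=\sum_k(p_k\partial_{p_k}+q^k\partial_{q^k})$. The contact Hamiltonian vector field of $h\in C^\infty(\mathbb{R}^{2n+1})$ is $$X_h=\sum_k(\partial_{p_k}h\,\partial_{q^k}-\partial_{q^k}h\,\partial_{p_k})+\mathcal{E}_s(h)\,\partial_t-\partial_th\,\mathcal{E}_s-2h\,\partial_t.$$ The Lie algebra $\mathrm{sp}_{2n+2}$ is $\{X_h: h\text{ a polynomial of degree}\le2\text{ in }(p,q,t)\}$; it is isomorphic to $\mathrm{sp}(2n+2,\mathbb{R})$. For $k\in\mathbb{N}$, $\delta\in\mathbb{R}$, $\mathcal{S}^k_\delta(\mathbb{R}^{2n+1})=\Gamma(S^kT\mathbb{R}^{2n+1}\otimes\mathbb{F}_\delta)$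 is the space of symmetric contravariant $k$-tensor fields with values in $\delta$-densities. Its elements are viewed as polynomials $S(\xi)$, homogeneous of degree $k$ in the fiber coordinates $\xi=(\xi_{p_i},\xi_{q^i},\xi_t)$, with coefficients in $C^\infty(\mathbb{R}^{2n+1})$. A vector field $Z=Z^i\partial_i$ acts on $P\in\mathcal{S}^k_\delta$ by the canonical action $L_ZP=Z(P)-\partial_jZ^i\,\xi_i\,\partial_{\xi_j}P+\delta\,\partial_iZ^i\,P$. On $R^k_\delta=\mathcal{S}^k_{\delta+\frac{k}{n+1}}(\mathbb{R}^{2n+1})$ the weight $\delta$ in this formula is thus replaced by $\delta+\frac{k}{n+1}$. The Casimir operator is $C^k_\delta=\sum_aL_{b_a}\circ L_{b_a^*}$ on $R^k_\delta$, where $(b_a)$ is a basis of $\mathrm{sp}_{2n+2}$ and $(b_a^* )$ the dual basis with respect to the Killing form. The operator $i_\alpha:\mathcal{S}^k_\delta\to\mathcal{S}^{k-1}_{\delta-\frac1{n+1}}$ is $$(i_\alpha S)(\xi)=\tfrac12\Big(\sum_j(p_j\partial_{\xi_{q^j}}-q^j\partial_{\xi_{p_j}})-\partial_{\xi_t}\Big)S(\xi)$$ (zero for $k=0$), so $i_\alpha:R^k_\delta\to R^{k-1}_\delta$. The generalized Hamiltonian $X:\mathcal{S}^k_\delta\to\mathcal{S}^{k+1}_{\delta+\frac1{n+1}}$ is $$X(S)(\xi)=\sum_j(\xi_{q^j}\partial_{p_j}-\xi_{p_j}\partial_{q^j})S(\xi)+\xi_t\,\mathcal{E}_sS(\xi)-\Big(\sum_j(p_j\xi_{p_j}+q^j\xi_{q^j})\Big)\partial_tS(\xi)+\big(2(n+1)\delta-k\big)\xi_tS(\xi),$$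 so $X:R^k_\delta\to R^{k+1}_\delta$, the constant in the last term being computed with the actual density weight $\delta+\frac{k}{n+1}$ of elements of $R^k_\delta$, i.e. it equals $2(n+1)\delta+k$ there. *)

(* Defs.v *)
(* The notations of mpoly clash with those of MathComp-Analysis and are not
   imported. *)
From HB Require Import structures.
From mathcomp Require Import all_boot all_order all_algebra.
From mathcomp Require Import all_classical all_reals all_analysis.
From mathcomp.multinomials Require Import -(notations) mpoly.
Set Implicit Arguments.
Unset Strict Implicit.
Unset Printing Implicit Defensive.
Import Order.TTheory GRing.Theory Num.Theory.
Import numFieldNormedType.Exports.
Local Open Scope classical_set_scope.
Local Open Scope ring_scope.

Section EuclideanSpace.
Variables (R : realType) (d : nat).
Implicit Types (f : 'rV[R]_d -> R) (i j : 'I_d).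

Definition vector_field := 'rV[R]_d -> 'rV[R]_d.

Definition coordinate i : 'rV[R]_d -> R := fun x => x 0 i.

Definition partial_deriv i f : 'rV[R]_d -> R := fun x => 'D_('e_i) f x.

Fixpoint Ck (r : nat) f : Prop :=
  match r with
  | 0 => continuous f
  | s.+1 => forall i,
      (forall x, derivable f x 'e_i) /\ Ck s (partial_deriv i f)
  end.

Definition smooth f : Prop := forall r, Ck r f.

Definition component (Z : vector_field) i : 'rV[R]_d -> R := fun x => Z x 0 i.

Definition vf_apply (Z : vector_field) f : 'rV[R]_d -> R :=
  \sum_i component Z i * partial_deriv i f.

Definition lie_bracket (Y Z : vector_field) : vector_field := fun x =>
  \row_i (vf_apply Y (component Z i) x - vf_apply Z (component Y i) x).

Definition is_basis (g : set vector_field) (N : nat)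
    (b : 'I_N -> vector_field) : Prop :=
  (forall c : 'rV[R]_N, \sum_a c 0 a *: b a = 0 -> c = 0) /\
  g = [set Z | exists c : 'rV[R]_N, Z = \sum_a c 0 a *: b a].

Definition coords (N : nat) (b : 'I_N -> vector_field) (Z : vector_field)
    : 'rV[R]_N :=
  xget 0 [set c : 'rV[R]_N | Z = \sum_a c 0 a *: b a].

(* Rows are the images of the basis vectors, as usual for row vectors. *)
Definition matrix_in (N : nat) (b : 'I_N -> vector_field)
    (f : vector_field -> vector_field) : 'M[R]_N :=
  \matrix_(i, j) coords b (f (b i)) 0 j.

(* The trace of an endomorphism f of the finite-dimensional space g: the
   common value of \tr (matrix_in b f) over all the bases b of g. *)
Definition trace_on (g : set vector_field) (f : vector_field -> vector_field)
    : R :=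
  xget 0 [set tau | exists (N : nat) (b : 'I_N -> vector_field),
                      is_basis g b /\ tau = \tr (matrix_in b f)].

Definition killing (g : set vector_field) (Y Z : vector_field) : R :=
  trace_on g (lie_bracket Y \o lie_bracket Z).

Definition is_dual_basis (g : set vector_field) (N : nat)
    (b bstar : 'I_N -> vector_field) : Prop :=
  (forall a, g (bstar a)) /\
  (forall a c, killing g (b a) (bstar c) = (a == c)%:R).

(* Polynomials S(xi) in the fiber coordinates xi_0, ..., xi_(d-1), with
   functions on R^d as coefficients. A function f acts by f *: S, and a real
   constant c by cst c *: S. *)
Definition symbol := mpoly d ('rV[R]_d -> R).

(* Symmetric contravariant k-tensor fields. The density weight is not
   recorded: in the coordinates of R^d it only enters the operators. *)
Definition is_symbol (k : nat) (S : symbol) : Prop :=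
  (S \is ishomog1 k mdeg) /\ (forall m, smooth (mcoeff m S)).

Definition xi i : symbol := mpolyX _ (mnm1 i).

Definition dxi i (S : symbol) : symbol := mderiv i S.

Definition dx i (S : symbol) : symbol := map_mpoly (partial_deriv i) S.

Definition symbol_apply (Z : vector_field) (S : symbol) : symbol :=
  \sum_i component Z i *: dx i S.

Definition lie_derivative (w : R) (Z : vector_field) (S : symbol) : symbol :=
  symbol_apply Z S
  - \sum_i \sum_j partial_deriv j (component Z i) *: (xi i * dxi j S)
  + (cst w * \sum_i partial_deriv i (component Z i)) *: S.

Definition casimir (w : R) (N : nat) (b bstar : 'I_N -> vector_field)
    (S : symbol) : symbol :=
  \sum_a lie_derivative w (b a) (lie_derivative w (bstar a) S).

End EuclideanSpace.

(* The canonical coordinates are ordered as p_1, ..., p_n, q^1, ..., q^n, t. *)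
Notation cdim n := (n + n + 1)%N.

Section Contact.
Variables (R : realType) (n : nat).

Definition ip (j : 'I_n) : 'I_(cdim n) := lshift 1 (lshift n j).
Definition iq (j : 'I_n) : 'I_(cdim n) := lshift 1 (rshift n j).
Definition it : 'I_(cdim n) := rshift (n + n) ord0.

Local Notation p j := (@coordinate R _ (ip j)).
Local Notation q j := (@coordinate R _ (iq j)).

Definition euler : vector_field R (cdim n) := fun x =>
  \sum_k (p k x *: 'e_(ip k) + q k x *: 'e_(iq k)).

Definition contact_field (h : 'rV[R]_(cdim n) -> R)
    : vector_field R (cdim n) := fun x =>
  \sum_k (partial_deriv (ip k) h x *: 'e_(iq k)
          - partial_deriv (iq k) h x *: 'e_(ip k))
  + vf_apply euler h x *: 'e_it
  - partial_deriv it h x *: euler x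
  - (2 * h x) *: 'e_it.

(* msize is the total degree plus one. *)
Definition sp_contact : set (vector_field R (cdim n)) :=
  [set Z | exists h : mpoly (cdim n) R,
             (msize h <= 3)%N /\ Z = contact_field (fun x => meval (x 0) h)].

Definition i_alpha (S : symbol R (cdim n)) : symbol R (cdim n) :=
  cst 2^-1 *:
    (\sum_j (p j *: dxi (iq j) S - q j *: dxi (ip j) S) - dxi it S).

(* The generalized Hamiltonian X on k-tensor fields of density weight w. *)
Definition gen_hamiltonian (k : nat) (w : R) (S : symbol R (cdim n))
    : symbol R (cdim n) :=
  \sum_j (xi R (iq j) * dx (ip j) S - xi R (ip j) * dx (iq j) S)
  + xi R it * symbol_apply euler S
  - (\sum_j (p j *: xi R (ip j) + q j *: xi R (iq j))) * dx it S
  + cst (2 * n.+1%:R * w - k%:R) *: (xi R it * S).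

(* The density weight of the elements of R^k_delta. *)
Definition R_weight (k : nat) (delta : R) : R := delta + k%:R / n.+1%:R.

Definition X_R (k : nat) (delta : R) : symbol R (cdim n) -> symbol R (cdim n) :=
  gen_hamiltonian k (R_weight k delta).

(* 0 <= p <= 2k - 2 is written p + 2 <= 2k, which is empty for k = 0. *)
Definition critical (k : nat) : set R :=
  [set delta | exists p : nat,
     (p + 2 <= 2 * k)%N /\ delta = - p%:R / (2 * n.+1%:R)].

Definition casimir_const (k : nat) (delta : R) : R :=
  n.+1%:R ^+ 2 * delta ^+ 2 - n.+1%:R ^+ 2 * delta + k%:R * n.+1%:R * delta
  + (k%:R ^+ 2 - k%:R) / 2.

End Contact.

Arguments sp_contact : clear implicits.

(* Main.v *)
(** In the homogeneous coordinates z = (p, q, t, 1) of R^(2n+2), a contact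
    Hamiltonian of degree at most 2 is a quadratic form, and its contact field is
    the projective field [projective_field A] of a matrix A fixed by the
    involution [theta A = J A^T J], that is, an element of sp(2n+2).  Traces over
    the frame P E_ij, where P = (1 + theta)/2, give the Killing form
    (2n+4) tr(AB).  Hence, with L_ij the Lie derivative along z_i d/dz_j, the
    Casimir operator is 1/(4(n+2)) times
      sum_ij (L_ji - s_i s_j L_i'j') L_ij,
    where ' exchanges p_k with q^k and t with the last coordinate and s is the
    sign of J.  Each L_ij is a first-order operator satisfying Weyl-type
    commutation rules.  The sum of the L_ji L_ij is a scalar.  In the other sum
    the second-order part vanishes because J is antisymmetric, so that the
    symmetry of second derivatives is not needed; it reduces to a scalar plus a
    multiple of X o i_alpha. *)
Require Import Defs.
From HB Require Import structures.
From mathcomp Require Import all_boot all_order all_algebra.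
From mathcomp Require Import all_classical all_reals all_analysis.
From mathcomp.multinomials Require Import -(notations) mpoly.
From mathcomp Require Import ring lra.
Import Order.TTheory GRing.Theory Num.Theory.
Import numFieldNormedType.Exports.
Set Implicit Arguments.
Unset Strict Implicit.
Unset Printing Implicit Defensive.
Local Open Scope classical_set_scope.
Local Open Scope ring_scope.

(** * Smooth functions and symbols *)

(** The coordinate t enters the contact fields and i_alpha without a conjugate partner. The extra
    homogeneous coordinate [tau] supplies one, and Euler's relation in degree k - N w, with N =
    2n+2, determines the derivative along it, so no new unknown appears. Projective fields exist for
    all matrices and the identity matrix gives the zero field; hence one may work with the E_ij of
    gl(2n+2) instead of a basis of sp(2n+2). The half of P given by the identity yields the Casimir
    operator of gl(2n+2), which knows nothing of the contact structure and can only be a scalar on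
    symbols of fixed degree and weight. The half given by [theta] brings in J, and with it i_alpha
    and X. Derivatives are additive only on smooth functions. The commutation rules are therefore
    assumed in an abstract commutative ring with a smoothness predicate, where each step is a [ring]
    identity, and are verified for symbols separately. Divisions take place in R only, in the
    comparison of the constants. *)

Section Smooth.
Variables (R : realType) (d : nat).
Implicit Types (f g : 'rV[R]_d -> R) (i j : 'I_d).

Lemma smooth_derivable f i x : smooth f -> derivable f x 'e_i.
Proof. by move=> /(_ 1%N) /= /(_ i) []. Qed.

Lemma smooth_partial f i : smooth f -> smooth (partial_deriv i f).
Proof. by move=> fS r; case: (fS r.+1 i). Qed.

Lemma smooth_continuous f : smooth f -> continuous f.
Proof. by move=> /(_ 0%N). Qed.

Lemma partial_derivD i f g : smooth f -> smooth g ->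
  partial_deriv i (f + g) = partial_deriv i f + partial_deriv i g.
Proof.
by move=> fS gS; apply/funext => x; rewrite /partial_deriv deriveD //;
  exact: smooth_derivable.
Qed.

Lemma partial_derivN i f : smooth f -> partial_deriv i (- f) = - partial_deriv i f.
Proof.
by move=> fS; apply/funext => x; rewrite /partial_deriv deriveN //;
  exact: smooth_derivable.
Qed.

Lemma partial_derivM i f g : smooth f -> smooth g ->
  partial_deriv i (f * g) = partial_deriv i f * g + f * partial_deriv i g.
Proof.
move=> fS gS; apply/funext => x; rewrite /partial_deriv deriveM;
  [|exact: smooth_derivable..].
by rewrite addrC !fctE /GRing.scale /= [g x * _]mulrC.
Qed.

Lemma partial_deriv_cst i (c : R) : partial_deriv i (cst c) = 0.
Proof. by apply/funext => x; rewrite /partial_deriv derive_cst. Qed.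

Lemma is_derive_coordinate j i x :
  is_derive x 'e_i (coordinate j : 'rV[R]_d -> R) (i == j)%:R.
Proof.
have d1 : is_derive x 'e_i (id : 'rV[R]_d -> _) 'e_i by exact: is_derive_id.
have := @derivable_mxP R _ 1 d id x 'e_i.
case=> /(_ (@ex_derive _ _ _ _ _ _ _ d1) 0 j) h _.
apply: DeriveDef; first exact: h.
have := @derive_mx R _ 1 d id x 'e_i (@ex_derive _ _ _ _ _ _ _ d1).
move=> /matrixP /(_ 0 j); rewrite derive_id !mxE => <-.
by rewrite eqxx /= eq_sym.
Qed.

Lemma partial_deriv_coordinate i j :
  partial_deriv i (coordinate j : 'rV[R]_d -> R) = cst (i == j)%:R.
Proof.
by apply/funext => x; have [_ h] := is_derive_coordinate j i x.
Qed.

Lemma smooth_cst (c : R) : smooth (cst c : 'rV[R]_d -> R).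
Proof.
move=> r; elim: r c => [|r IH] c /=; first exact: cst_continuous.
move=> i; split=> [x|]; first exact: derivable_cst.
by rewrite partial_deriv_cst; exact: IH.
Qed.

Lemma smooth_coordinate j : smooth (coordinate j : 'rV[R]_d -> R).
Proof.
case=> [|r] /=; first exact: coord_continuous.
move=> i; split=> [x|]; first by have [] := is_derive_coordinate j i x.
by rewrite partial_deriv_coordinate; exact: smooth_cst.
Qed.

Lemma Ck_add r f g : Ck r f -> Ck r g -> Ck r (f + g).
Proof.
elim: r f g => [|r IH] f g /= fS gS.
  by move=> x; apply: continuousD; [exact: fS|exact: gS].
move=> i; have [fd fS'] := fS i; have [gd gS'] := gS i.
split=> [x|]; first exact: derivableD.
suff -> : partial_deriv i (f + g) = partial_deriv i f + partial_deriv i g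
  by exact: IH.
by apply/funext => x; rewrite /partial_deriv deriveD.
Qed.

Lemma smoothD f g : smooth f -> smooth g -> smooth (f + g).
Proof. by move=> fS gS r; apply: Ck_add. Qed.

Lemma smoothM f g : smooth f -> smooth g -> smooth (f * g).
Proof.
move=> fS gS r; elim: r f g fS gS => [|r IH] f g fS gS /=.
  by move=> x; apply: continuousM; exact: smooth_continuous.
move=> i; split=> [x|]; first by apply: derivableM; exact: smooth_derivable.
rewrite partial_derivM //.
by apply: Ck_add; apply: IH => //; exact: smooth_partial.
Qed.

Lemma smoothN f : smooth f -> smooth (- f).
Proof.
move=> fS; have -> : - f = cst (-1) * f by apply/funext => x; rewrite !fctE mulN1r.
exact/smoothM/fS/smooth_cst.
Qed.

Lemma smooth_sum (I : Type) (r : seq I) (P : pred I) (F : I -> 'rV[R]_d -> R) :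
  (forall a, P a -> smooth (F a)) -> smooth (\sum_(a <- r | P a) F a).
Proof.
move=> FS; apply: (big_ind (fun f => smooth f)) => //; last exact: smoothD.
exact: (smooth_cst 0).
Qed.

Lemma partial_deriv_sum i (I : Type) (r : seq I) (P : pred I)
    (F : I -> 'rV[R]_d -> R) :
  (forall a, smooth (F a)) ->
  partial_deriv i (\sum_(a <- r | P a) F a) =
  \sum_(a <- r | P a) partial_deriv i (F a).
Proof.
move=> FS; elim: r => [|a r IH].
  by rewrite !big_nil; exact: (partial_deriv_cst _ 0).
rewrite !big_cons; case: (P a) => //.
by rewrite partial_derivD ?IH //; apply: smooth_sum.
Qed.

End Smooth.

(** [partial_deriv i] is not a ring morphism, and it is additive only where derivatives exist.
    Fixing zero suffices here, because coefficients off the support vanish. *)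
Lemma mcoeff_map_mpoly0 (n : nat) (A B : nzRingType) (f : A -> B) (p : mpoly n A)
  (m : multinom n) : f 0 = 0 -> mcoeff m (map_mpoly f p) = f (mcoeff m p).
Proof.
move=> f0; rewrite /map_mpoly /mmap raddf_sum /=.
have h m' : mmap1 (fun j => mpolyX B (mnm1 j)) m' = mpolyX B m'.
  by rewrite /mmap1 mpolyXE_id.
under eq_bigr do rewrite h mcoeffCM mcoeffX.
have [mS|mS] := boolP (m \in msupp p).
  rewrite (bigD1_seq m) //= eqxx mulr1 big1 ?addr0 // => m' /negPf ->.
  by rewrite mulr0.
rewrite (memN_msupp_eq0 mS) f0 big_seq big1 // => m' m'S.
by case: eqP mS => [<-|_ _]; rewrite ?m'S ?mulr0.
Qed.

Section Symbols.
Variables (R : realType) (d : nat).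
Local Notation F := ('rV[R]_d -> R).
Local Notation symb := (symbol R d).
Implicit Types (f g : F) (S T : symb) (i j : 'I_d).

(** The smoothness half of [is_symbol]. Unlike homogeneity of a given degree, it is stable under
    sums, products and all the operators, so it can serve as the predicate [ok] below. *)
Definition smooth_symbol S := forall m, smooth (mcoeff m S).

Lemma mcoeff_dx i S m : mcoeff m (dx i S) = partial_deriv i (mcoeff m S).
Proof. by apply: mcoeff_map_mpoly0; exact: (partial_deriv_cst _ 0). Qed.

(* Keeps unification from unfolding [dx] when a rewrite rule fails to match. *)
Local Opaque dx.

Lemma smooth_symbolD S T : smooth_symbol S -> smooth_symbol T -> smooth_symbol (S + T).
Proof. by move=> SS TS m; rewrite mcoeffD; apply: smoothD. Qed.

Lemma smooth_symbol0 : smooth_symbol 0.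
Proof. by move=> m; rewrite mcoeff0; exact: (smooth_cst _ 0). Qed.

Lemma smooth_symbol_sum (I : Type) (r : seq I) (G : I -> symb) :
  (forall a, smooth_symbol (G a)) -> smooth_symbol (\sum_(a <- r) G a).
Proof.
move=> GS; apply: (big_ind smooth_symbol) => //; first exact: smooth_symbol0.
exact: smooth_symbolD.
Qed.

Lemma smooth_symbolM S T : smooth_symbol S -> smooth_symbol T -> smooth_symbol (S * T).
Proof.
move=> SS TS m; rewrite mcoeffM; apply: smooth_sum => k _; exact: smoothM.
Qed.

Lemma smooth_symbolC f : smooth f -> smooth_symbol (mpolyC d f).
Proof.
move=> fS m; rewrite mcoeffC; apply: smoothM => //.
by case: eqP => _; [exact: (smooth_cst _ 1)|exact: (smooth_cst _ 0)].
Qed.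

Lemma smooth_symbol_xi i : smooth_symbol (xi R i).
Proof.
move=> m; rewrite mcoeffX.
by case: eqP => _; [exact: (smooth_cst _ 1)|exact: (smooth_cst _ 0)].
Qed.

Lemma smooth_symbol_dx i S : smooth_symbol S -> smooth_symbol (dx i S).
Proof. by move=> SS m; rewrite mcoeff_dx; exact: smooth_partial. Qed.

Lemma smooth_mulrn f k : smooth f -> smooth (f *+ k).
Proof.
move=> fS; elim: k => [|k IH]; first exact: (smooth_cst _ 0).
by rewrite mulrS; exact: smoothD.
Qed.

Lemma smooth_symbol_dxi i S : smooth_symbol S -> smooth_symbol (dxi i S).
Proof. by move=> SS m; rewrite mcoeff_deriv; exact: smooth_mulrn. Qed.

Lemma smooth_symbolN S : smooth_symbol S -> smooth_symbol (- S).
Proof. by move=> SS m; rewrite mcoeffN; apply: smoothN. Qed.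

Lemma dxD i S T : smooth_symbol S -> smooth_symbol T -> dx i (S + T) = dx i S + dx i T.
Proof.
move=> SS TS; apply/mpolyP => m.
rewrite [LHS]mcoeff_dx [in LHS]mcoeffD [LHS]partial_derivD //.
by rewrite [RHS]mcoeffD; congr (_ + _); rewrite mcoeff_dx.
Qed.

Lemma dxM i S T : smooth_symbol S -> smooth_symbol T ->
  dx i (S * T) = dx i S * T + S * dx i T.
Proof.
move=> SS TS; apply/mpolyP => m.
rewrite [RHS]mcoeffD [X in X + _]mcoeffM [X in _ + X]mcoeffM -big_split /=.
rewrite [LHS]mcoeff_dx [in LHS]mcoeffM.
rewrite [LHS]partial_deriv_sum; last by move=> k; exact: smoothM.
apply: eq_bigr => k _; rewrite [LHS]partial_derivM //.
by congr (_ * _ + _ * _); rewrite mcoeff_dx.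
Qed.

Lemma dxC i f : dx i (mpolyC d f) = mpolyC d (partial_deriv i f).
Proof.
apply/mpolyP => m; rewrite mcoeff_dx !mcoeffC.
by case: eqP => _; rewrite ?mulr1 ?mulr0 //; exact: (partial_deriv_cst _ 0).
Qed.

Lemma dx_xi i j : dx i (xi R j) = 0.
Proof.
apply/mpolyP => m; rewrite mcoeff_dx mcoeffX mcoeff0.
by case: eqP => _; [exact: (partial_deriv_cst _ 1)|exact: (partial_deriv_cst _ 0)].
Qed.

Lemma partial_deriv_mulrn i f k : smooth f ->
  partial_deriv i (f *+ k) = partial_deriv i f *+ k.
Proof.
move=> fS; elim: k => [|k IH]; first exact: (partial_deriv_cst _ 0).
by rewrite !mulrS partial_derivD ?IH //; exact: smooth_mulrn.
Qed.

Lemma dx_dxi i j S : smooth_symbol S -> dx i (dxi j S) = dxi j (dx i S).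
Proof.
move=> SS; apply/mpolyP => m.
by rewrite mcoeff_dx !mcoeff_deriv mcoeff_dx partial_deriv_mulrn.
Qed.

Lemma dxi_xi i j : dxi i (xi R j) = (i == j)%:R.
Proof.
rewrite /dxi mderivX mnm1E eq_sym; case: eqP => [<-|_]; last by rewrite scale0r.
rewrite scale1r; suff -> : mnm_sub (mnm1 i) (mnm1 i) = mnm0 by rewrite mpolyX0.
by apply/mnmP => l; rewrite mnmBE subnn mnm0E.
Qed.

End Symbols.

(** * Lie derivatives along linear fields in homogeneous coordinates *)

(* [X a] is the homogeneous coordinate z_a in the chart z_tau = 1, [sg a] the
   symbol of d/dz_a on functions of degree 0 (so [sg tau = - sum_i x_i xi_i]),
   [ii a] the derivation d/dxi_a, and [D a] is d/dz_a acting on symbols of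
   weight [w], seen as homogeneous of degree k - N w where k is the fiber degree;
   thus [D tau] is minus the Euler field plus that degree.  The predicate [ok]
   stands for smoothness, without which [D] is not additive. *)
Section OperatorAlgebra.
Variables (A : comNzRingType) (I : finType) (star : I -> I) (t tau : I).
Variables (X sg s : I -> A) (D ii : I -> A -> A) (w : A) (ok : A -> Prop).
Implicit Types (a b c : I) (S T : A).

Local Notation delta a b := (@GRing.natmul A 1 (nat_of_bool (a == b))).
Local Notation N := (@GRing.natmul A 1 #|I|).

Hypothesis starK : involutive star.
Hypothesis star_tau : star tau = t.
Hypothesis s_star : forall a, s (star a) = - s a.
Hypothesis s_sqr : forall a, s a * s a = 1.
Hypothesis s_t : s t = 1.

Hypothesis two_regular : forall S, S + S = 0 -> S = 0.

Hypothesis okD : forall S T, ok S -> ok T -> ok (S + T).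
Hypothesis okM : forall S T, ok S -> ok T -> ok (S * T).
Hypothesis okN : forall S, ok S -> ok (- S).
Hypothesis ok1 : ok 1.
Hypothesis okX : forall a, ok (X a).
Hypothesis ok_sg : forall a, ok (sg a).
Hypothesis ok_s : forall a, ok (s a).
Hypothesis ok_w : ok w.
Hypothesis ok_D : forall a S, ok S -> ok (D a S).
Hypothesis ok_ii : forall a S, ok S -> ok (ii a S).

Hypothesis D_add : forall a S T, ok S -> ok T -> D a (S + T) = D a S + D a T.
Hypothesis D_w : forall a S, ok S -> D a (w * S) = w * D a S.
Hypothesis D_s : forall a b S, ok S -> D a (s b * S) = s b * D a S.
(** The corrections at [tau] in this and the next two rules record homogeneity: [X a] stands for
    z_a/z_tau, of degree 0, while [sg c] raises the degree by one and [ii c] lowers it by one. *)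
Hypothesis D_X : forall b a S, ok S ->
  D b (X a * S) = X a * D b S + (delta a b - delta b tau * X a) * S.
Hypothesis D_sg : forall b c S, ok S ->
  D b (sg c * S) = sg c * D b S + (delta b tau * sg c - delta c tau * sg b) * S.
Hypothesis D_ii : forall b c S, ok S ->
  D b (ii c S) = ii c (D b S) - delta b tau * ii c S.
Hypothesis ii_add : forall a S T, ii a (S + T) = ii a S + ii a T.
Hypothesis ii_w : forall a S, ii a (w * S) = w * ii a S.
Hypothesis ii_s : forall a b S, ii a (s b * S) = s b * ii a S.
Hypothesis ii_X : forall a b S, ii a (X b * S) = X b * ii a S.
Hypothesis ii_sg : forall a b S,
  ii a (sg b * S) = sg b * ii a S + (delta a b - delta b tau * X a) * S.
Hypothesis ii_ii : forall a b S, ii a (ii b S) = ii b (ii a S).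
Hypothesis ii_tau : forall S, ii tau S = 0.
Hypothesis X_tau : X tau = 1.
Hypothesis sum_X_sg : \sum_a X a * sg a = 0.
Hypothesis sum_X_D : forall S, ok S ->
  \sum_a X a * D a S = \sum_a sg a * ii a S - N * w * S.

(* The Lie derivative along z_a d/dz_b. *)
Definition gl_op a b S := X a * D b S - sg b * ii a S + w * delta a b * S.
Local Notation L := gl_op.

(** The symplectic pairing of the position z with the fibre derivations, which is -2 i_alpha
    ([i_alphaE]). The pairing of [sg] with [D] in [hamilton_op] is -X up to a multiple of [sg t]
    ([gen_hamiltonianE]). *)
Definition contact_op S := \sum_a s a * X (star a) * ii a S.
Definition hamilton_op S := \sum_b s b * sg b * D (star b) S.

Lemma ok_nat k : ok k%:R.
Proof.
elim: k => [|k IH]; last by rewrite -[k.+1]addn1 natrD; exact: okD.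
by rewrite mulr0n -(subrr 1); apply: okD => //; apply: okN.
Qed.

Lemma D0 a : D a 0 = 0.
Proof.
have h := ok_nat 0; have /eqP := D_add a h h.
by rewrite addr0 -subr_eq0 opprD addrA subrr sub0r oppr_eq0 => /eqP.
Qed.

Lemma D_opp a S : ok S -> D a (- S) = - D a S.
Proof.
by move=> oS; apply/eqP; rewrite -addr_eq0 -D_add ?addNr ?D0 //; exact: okN.
Qed.

Lemma D_nat a k S : ok S -> D a (k%:R * S) = k%:R * D a S.
Proof.
move=> oS; elim: k => [|k IH]; first by rewrite !mul0r D0.
rewrite -[k.+1]addn1 natrD !mulrDl !mul1r D_add ?IH //.
by apply: okM => //; exact: ok_nat.
Qed.

Lemma ii0 a : ii a 0 = 0.
Proof.
have /eqP := ii_add a 0 0.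
by rewrite addr0 -subr_eq0 opprD addrA subrr sub0r oppr_eq0 => /eqP.
Qed.

Lemma ii_opp a S : ii a (- S) = - ii a S.
Proof. by apply/eqP; rewrite -addr_eq0 -ii_add addNr ii0. Qed.

Lemma ii_nat a k S : ii a (k%:R * S) = k%:R * ii a S.
Proof.
elim: k => [|k IH]; first by rewrite !mul0r ii0.
by rewrite -[k.+1]addn1 natrD !mulrDl !mul1r ii_add ?IH.
Qed.

Lemma D_sum b (F : I -> A) :
  (forall a, ok (F a)) -> D b (\sum_a F a) = \sum_a D b (F a).
Proof.
(* Additivity of [D] requires smooth partial sums, so the induction runs over the list of indices
   and proves their smoothness on the way. *)
move=> oF; rewrite !unlock /=; elim: (index_enum I) => [|a r IH] /=.
  exact: D0.
rewrite D_add ?IH //; elim: (r) => [|c r' oR] /=; first exact: (ok_nat 0).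
exact: okD.
Qed.

Lemma ii_sum b (F : I -> A) : ii b (\sum_a F a) = \sum_a ii b (F a).
Proof. by apply: (big_morph (ii b)); [exact: ii_add|exact: ii0]. Qed.

Lemma sum_delta b (F : I -> A) : \sum_a delta a b * F a = F b.
Proof.
rewrite (bigD1 b) //= eqxx mul1r big1 ?addr0 // => a /negPf ->.
by rewrite mul0r.
Qed.

Lemma sum_star (F : I -> A) : \sum_a F (star a) = \sum_a F a.
Proof. by rewrite [RHS](reindex_inj (inv_inj starK)). Qed.

Lemma sum_antisym (F : I -> A) : (forall a, F (star a) = - F a) -> \sum_a F a = 0.
Proof.
move=> hF; apply: two_regular.
by rewrite -{1}sum_star -big_split /= big1 // => a _; rewrite hF addNr.
Qed.

Lemma eq_star a b : (star a == star b) = (a == b).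
Proof. exact: (inj_eq (inv_inj starK)). Qed.

Lemma eq_star_tau b : (star b == tau) = (b == t).
Proof. by rewrite -star_tau -(eq_star _ tau) starK. Qed.


Lemma star_of_t : star t = tau. Proof. by rewrite -star_tau starK. Qed.

Lemma s_tau : s tau = -1.
Proof. by rewrite -star_of_t s_star s_t. Qed.

Variables (k : nat) (S : A).
Hypothesis oS : ok S.
Hypothesis degS : \sum_a sg a * ii a S = k%:R * S.
Local Notation lam := (k%:R - N * w : A).

Let sum_XDS : \sum_a X a * D a S = lam * S.
Proof. by rewrite sum_X_D // degS mulrBl. Qed.

(** Base derivations preserve the fibre degree, so Euler's relation has the same factor [lam] on
    [D b S] as on [S]. *)
Let deg_DS b : \sum_a sg a * ii a (D b S) = k%:R * D b S.
Proof.
have E a : sg a * ii a (D b S)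
    = D b (sg a * ii a S) + delta a tau * (sg b * ii a S).
  by rewrite D_sg ?D_ii //; [ring|exact: ok_ii].
under eq_bigr do rewrite E.
rewrite big_split /= sum_delta ii_tau mulr0 addr0 -D_sum ?degS ?D_nat //.
by move=> a; apply: okM => //; exact: ok_ii.
Qed.

(** N counts the derivatives of the [X a], and -1 is the correction at [tau]: only N - 1 of the
    quotients z_a/z_tau are independent. The N - 1 of [sum_ii_sg] arises likewise, [sg tau] being a
    combination of the others. *)
Let sum_D_XDS b : \sum_a D a (X a * D b S) = (lam + N - 1) * D b S.
Proof.
have E a : D a (X a * D b S)
   = X a * D a (D b S) + D b S - delta a tau * (X a * D b S).
  by rewrite D_X ?eqxx /=; [ring|exact: ok_D].
under eq_bigr do rewrite E.
rewrite sumrB big_split /= sum_delta X_tau sum_X_D ?deg_DS ?sumr_const; last exact: ok_D.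
by rewrite -mulr_natl -[#|_|]/(#|I|); ring.
Qed.

Let sum_D_sg_ii b : \sum_a D a (sg b * ii a S)
  = sg b * (\sum_a D a (ii a S)) - delta b tau * (k%:R * S).
Proof.
have E a : D a (sg b * ii a S)
   = sg b * D a (ii a S) + delta a tau * (sg b * ii a S) - delta b tau * (sg a * ii a S).
  by rewrite D_sg; [ring|exact: ok_ii].
under eq_bigr do rewrite E.
by rewrite sumrB big_split /= sum_delta ii_tau mulr0 addr0 -!mulr_sumr degS.
Qed.

Let sum_ii_sg T : \sum_b ii b (sg b * T) = \sum_b sg b * ii b T + (N - 1) * T.
Proof.
have E b : ii b (sg b * T) = sg b * ii b T + T - delta b tau * (X b * T).
  by rewrite ii_sg eqxx /=; ring.
under eq_bigr do rewrite E.
rewrite sumrB big_split /= sum_delta X_tau sumr_const -mulr_natl -[#|_|]/(#|I|).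
ring.
Qed.

Lemma deg_ii b : \sum_a sg a * ii a (ii b S)
  = k%:R * ii b S - ii b S.
Proof.
have E a : sg a * ii a (ii b S) = ii b (sg a * ii a S) - delta a b * ii a S
    + delta a tau * (X b * ii a S).
  by rewrite (ii_ii a) ii_sg [b == a]eq_sym; ring.
under eq_bigr do rewrite E.
rewrite big_split sumrB /= !sum_delta ii_tau mulr0 addr0 -ii_sum degS ii_nat.
by [].
Qed.

Lemma deg_contact : \sum_a sg a * ii a (contact_op S)
  = k%:R * contact_op S - contact_op S.
Proof.
under eq_bigr do rewrite ii_sum mulr_sumr.
rewrite exchange_big /= /contact_op mulr_sumr -sumrB; apply: eq_bigr => c _.
transitivity (s c * X (star c) * \sum_a sg a * ii a (ii c S)).
  rewrite mulr_sumr; apply: eq_bigr => a _.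
  by rewrite -[s c * X _ * ii _ _]mulrA ii_s ii_X; ring.
by rewrite deg_ii; ring.
Qed.

Let D_L c a b : D c (L a b S)
  = D c (X a * D b S) - D c (sg b * ii a S) + w * delta a b * D c S.
Proof.
have oDS := ok_D b oS; have oiS := ok_ii a oS.
rewrite /L -mulrA !D_add ?D_opp ?D_w ?D_nat //; first ring.
all: repeat first [exact: ok_nat | apply: okM => // | apply: okN | apply: okD].
Qed.

Let ii_L c a b : ii c (L a b S)
  = X a * ii c (D b S) - ii c (sg b * ii a S) + w * delta a b * ii c S.
Proof. by rewrite /L -mulrA !ii_add ii_opp ii_w ii_nat ii_X; ring. Qed.

Let sum_L_diag : \sum_a L a a S = 0.
Proof.
have E a : L a a S = X a * D a S - sg a * ii a S + w * S by rewrite /L eqxx /=; ring.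
under eq_bigr do rewrite E.
rewrite big_split sumrB /= sum_XDS degS sumr_const -mulr_natl -[#|_|]/(#|I|).
ring.
Qed.

(** In [X b * D a (X a * D b S)] the sum over a is Euler's relation for [D b S], and the sum over b
    is Euler's relation for [S]; [D a] and [D b] are never exchanged. The fibre part is treated in
    the same way, and the mixed terms collapse by [sum_X_sg]. *)
Lemma sum_gl_casimir : \sum_a \sum_b L b a (L a b S)
  = (lam * (lam + N - 1) + k%:R * (k%:R + N - 1) - N * w ^+ 2) * S.
Proof.
rewrite exchange_big /=.
have E b a : L b a (L a b S) = X b * D a (X a * D b S) - X b * D a (sg b * ii a S)
    + delta a b * (X b * (w * D a S))
    - (X a * sg a) * ii b (D b S) + sg a * ii b (sg b * ii a S)
    - delta a b * (w * (sg a * ii b S))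
    + delta a b * (w * L a b S).
  by rewrite {1}/L D_L ii_L [b == a]eq_sym; ring.
under eq_bigr do under eq_bigr do rewrite E.
under eq_bigr do rewrite !(big_split, sumrN) /= -!mulr_sumr -mulr_suml sum_X_sg
  sum_D_XDS sum_D_sg_ii !sum_delta mul0r.
rewrite !big_split /= !sumrN big1_eq -[\sum_i w * L i i S]mulr_sumr sum_L_diag.
have E1 (r : A) : \sum_i X i * (r * D i S) = r * (lam * S).
  by rewrite -sum_XDS mulr_sumr; apply: eq_bigr => i _; ring.
have E2 : \sum_i X i * (sg i * (\sum_a D a (ii a S)) - delta i tau * (k%:R * S))
    = - (k%:R * S).
  have F i U : X i * (sg i * U - delta i tau * (k%:R * S))
    = X i * sg i * U - delta i tau * (X i * (k%:R * S)) by ring.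
  under eq_bigr do rewrite F.
  by rewrite sumrB -mulr_suml sum_X_sg sum_delta X_tau mul0r; ring.
have E3 : \sum_i \sum_a sg a * ii i (sg i * ii a S)
    = (k%:R + N - 1) * (k%:R * S) - k%:R * S.
  rewrite exchange_big /= -degS [in RHS]mulr_sumr -sumrB; apply: eq_bigr => a _.
  by rewrite -mulr_sumr sum_ii_sg deg_ii; ring.
have E4 : \sum_i w * (sg i * ii i S) = w * (k%:R * S).
  by rewrite -degS mulr_sumr.
rewrite !E1 E2 E3 E4.

ring.
Qed.


Lemma starC_eq a b : (star a == b) = (a == star b).
Proof. by rewrite -(eq_star a) starK. Qed.

Lemma s_sstar a : s (star a) * s a = -1.
Proof. by rewrite s_star mulNr s_sqr. Qed.

(** Moving [X (star a)] under [D (star b)] makes the composite of the two operators appear; the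
    remaining terms are the corrections of [D_X]. *)
Let sum_X_sg_D_ii : \sum_b \sum_a s a * s b * (X (star a) * sg b) * D (star b) (ii a S)
  = hamilton_op (contact_op S) - k%:R * S + sg t * contact_op S.
Proof.
have E b a : s a * s b * (X (star a) * sg b) * D (star b) (ii a S)
   = s b * sg b * D (star b) (s a * X (star a) * ii a S)
     - delta a b * (s a * s b * (sg b * ii a S))
     + delta b t * (s b * sg b) * (s a * X (star a) * ii a S).
  rewrite -[s a * X _ * _]mulrA D_s ?D_X ?eq_star ?eq_star_tau; first ring.
  - exact: ok_ii.
  - by apply: okM => //; exact: ok_ii.
under eq_bigr do under eq_bigr do rewrite E.
under eq_bigr do rewrite big_split sumrB /= sum_delta -!mulr_sumr s_sqr mul1r.
rewrite big_split sumrB /= degS; congr (_ - _ + _).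
  rewrite /hamilton_op; apply: eq_bigr => b _; congr (_ * _).
  rewrite D_sum // => a; apply: okM; [exact: okM|exact: ok_ii].
by rewrite -mulr_suml sum_delta s_t mul1r.
Qed.

(** The two families of mixed terms differ by the relabelling [star], whose two signs cancel. This
    is the origin of the factor 2 in [sum_dual_casimir]. *)
Let sum_X_sg_D_ii_star :
  \sum_b \sum_a s a * s b * (X a * sg (star b)) * D b (ii (star a) S)
  = \sum_b \sum_a s a * s b * (X (star a) * sg b) * D (star b) (ii a S).
Proof.
rewrite -sum_star; apply: eq_bigr => b _; rewrite -sum_star; apply: eq_bigr => a _.
by rewrite !starK !s_star; ring.
Qed.

(** The terms with two [D] factor through the sum of [s a * X (star a) * X a], those with two [ii]
    through the sum of [s b * sg (star b) * sg b]; both sums are antisymmetric under [star]. Only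
    the mixed terms and multiples of [S] survive. *)
Lemma sum_dual_casimir :
  \sum_a \sum_b s a * s b * L (star a) (star b) (L a b S)
  = - ((hamilton_op (contact_op S) + 2%:R * sg t * contact_op S) *+ 2
       + (lam - k%:R + w * (k%:R - lam)) * S).
Proof.
rewrite exchange_big /=.
have E b a : s a * s b * L (star a) (star b) (L a b S) =
    s a * X (star a) * X a * (s b * D (star b) (D b S) - delta b t * s b * D b S)
  + delta a (star b) * (s a * s b * (X (star a) * D b S))
  - s a * s b * (X (star a) * sg b) * D (star b) (ii a S)
  - delta b t * s b * sg b * (s a * X (star a) * ii a S)
  + delta a b * (s a * s b * (w * (X (star a) * D (star b) S)))
  - s a * s b * (X a * sg (star b)) * D b (ii (star a) S)
  - delta b tau * s b * sg (star b) * (s a * X a * ii (star a) S)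
  + s b * sg (star b) * sg b * (s a * ii (star a) (ii a S))
  + delta a (star b) * (s a * s b * (sg (star b) * ii a S))
  - delta a b * (s a * s b * (w * (sg (star b) * ii (star a) S)))
  + delta a b * (s a * s b * (w * L a b S)).
  rewrite {1}/L D_L ii_L (D_X _ _ (ok_D _ oS)) (D_sg _ _ (ok_ii _ oS)) ii_sg.
  by rewrite (D_ii b (star a) oS) !eq_star ?eq_star_tau !starC_eq; ring.
under eq_bigr do under eq_bigr do rewrite E.
under eq_bigr do rewrite !(big_split, sumrN) /= -!mulr_sumr -!mulr_suml !sum_delta.
rewrite !(big_split, sumrN) /= -!mulr_suml.
rewrite sum_X_sg_D_ii_star sum_X_sg_D_ii.
rewrite [\sum_i s i * X (star i) * X i]sum_antisym; last first.
  by move=> a; rewrite starK s_star; ring.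
rewrite [\sum_i s i * sg (star i) * sg i]sum_antisym; last first.
  by move=> a; rewrite starK s_star; ring.
rewrite [\sum_i 0 * _]big1 => [|a _]; last by rewrite mul0r.
have -> : \sum_i delta i t * s i * sg i = sg t.
  by under eq_bigr do rewrite -mulrA; rewrite sum_delta s_t mul1r.
have -> : \sum_i delta i tau * s i * sg (star i) = - sg t.
  by under eq_bigr do rewrite -mulrA; rewrite sum_delta s_tau star_tau mulN1r.
have -> : \sum_i s (star i) * s i * (X (star (star i)) * D i S) = - (lam * S).
  by rewrite -sum_XDS -sumrN; apply: eq_bigr => a _; rewrite s_sstar starK mulN1r.
have -> : \sum_i s i * s i * (w * (X (star i) * D (star i) S)) = w * (lam * S).
  rewrite -sum_XDS mulr_sumr -[RHS]sum_star.
  by apply: eq_bigr => a _; rewrite s_sqr mul1r.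
have -> : \sum_i s i * X i * ii (star i) S = - contact_op S.
  rewrite /contact_op -sumrN -[RHS]sum_star.
  by apply: eq_bigr => a _; rewrite starK s_star; ring.
have -> : \sum_i s (star i) * s i * (sg (star i) * ii (star i) S) = - (k%:R * S).
  rewrite -degS -sumrN -[RHS]sum_star.
  by apply: eq_bigr => a _; rewrite s_sstar mulN1r.
have -> : \sum_i s i * s i * (w * (sg (star i) * ii (star i) S)) = w * (k%:R * S).
  rewrite -degS mulr_sumr -[RHS]sum_star.
  by apply: eq_bigr => a _; rewrite s_sqr mul1r.
have -> : \sum_i s i * s i * (w * L i i S) = 0.
  under eq_bigr do rewrite s_sqr mul1r.
  by rewrite -mulr_sumr sum_L_diag mulr0.
rewrite -/(contact_op S); ring.
Qed.

End OperatorAlgebra.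

(** * The Killing form of the symplectic algebra *)

Section SymplecticInvolution.
Variables (R : realType) (m : nat) (J : 'M[R]_m).
Hypothesis J_anti : J^T = - J.
Hypothesis J_sqr : J *m J = - 1%:M.
Implicit Types A B C D : 'M[R]_m.

(* The symplectic algebra is the fixed space of this map. *)
Definition symp_adj A := J *m A^T *m J.
Local Notation theta := symp_adj.
Definition symp_proj A := 2^-1 *: (A + theta A).
Local Notation P := symp_proj.

Lemma symp_adj_is_linear : linear theta.
Proof.
by move=> r A B; rewrite /theta linearP /= mulmxDr mulmxDl -scalemxAr -scalemxAl.
Qed.
HB.instance Definition _ :=
  GRing.isLinear.Build R 'M[R]_m 'M[R]_m _ theta symp_adj_is_linear.

Lemma symp_proj_is_linear : linear P.
Proof.
by move=> r A B; rewrite /P linearP /= addrACA -(scalerDr r) [LHS]scalerDr !scalerA mulrC.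
Qed.
HB.instance Definition _ :=
  GRing.isLinear.Build R 'M[R]_m 'M[R]_m _ P symp_proj_is_linear.

(** The sign comes from J^2 = -1. Because of it the fixed space of [theta] is closed under
    commutators rather than under products. *)
Lemma symp_adjM A B : theta (A *m B) = - (theta B *m theta A).
Proof.
rewrite /theta trmx_mul !mulmxA -[J *m B^T *m J *m J]mulmxA J_sqr.
by rewrite mulmxN mulmx1 !mulNmx opprK.
Qed.

Lemma symp_adjK : involutive theta.
Proof.
move=> A; rewrite /theta !trmx_mul trmxK J_anti !(mulNmx, mulmxN) opprK.
rewrite !mulmxA J_sqr -mulmxA J_sqr.
by rewrite !(mulNmx, mulmxN) mulmx1 mul1mx opprK.
Qed.

Lemma symp_proj_id A : theta A = A -> P A = A.
Proof. by move=> h; apply/matrixP => i j; rewrite /P h !mxE; field. Qed.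

Lemma symp_adj_proj A : theta (P A) = P A.
Proof. by rewrite /P linearZ /= linearD /= symp_adjK [theta A + A]addrC. Qed.

Lemma symp_commutator A B : theta A = A -> theta B = B ->
  theta (A *m B - B *m A) = A *m B - B *m A.
Proof. by move=> hA hB; rewrite linearB /= !symp_adjM hA hB opprK addrC. Qed.

Lemma mxtrace_symp_adj A : \tr (theta A) = - \tr A.
Proof.
by rewrite /theta mxtrace_mulC mulmxA J_sqr mulNmx mul1mx linearN /= mxtrace_tr.
Qed.

Lemma mxtrace_symp A : theta A = A -> \tr A = 0.
Proof.
move=> h; have := mxtrace_symp_adj A; rewrite h => /eqP.
by rewrite -addr_eq0 -mulr2n mulrn_eq0 /= => /eqP.
Qed.

(** [theta] is self-adjoint for tr(AB), since the two signs from J^T = -J cancel. In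
    [dual_basis_tensor] this removes [P] from a pairing with a symplectic matrix. *)
Lemma mxtrace_proj_mul A B : \tr (P A *m B) = \tr (A *m P B).
Proof.
rewrite /P -scalemxAl -scalemxAr !mxtraceZ mulmxDl mulmxDr !mxtraceD.
congr (_ * (_ + _)).
rewrite -mxtrace_tr trmx_mul /theta !trmx_mul trmxK J_anti.
by rewrite !(mulNmx, mulmxN) opprK !mulmxA [LHS]mxtrace_mulC !mulmxA mxtrace_mulC !mulmxA.
Qed.

Lemma mul_delta_mx_entry C D a b i j :
  (C *m delta_mx a b *m D) i j = C i a * D b j.
Proof.
rewrite !mxE (bigD1 b) //= big1 ?addr0 => [|k /negPf kb].
  rewrite mxE (bigD1 a) //= big1 ?addr0 ?mxE ?eqxx ?mulr1 // => l /negPf la.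
  by rewrite mxE la mulr0.
by rewrite mxE big1 ?mul0r // => l _; rewrite mxE kb andbF mulr0.
Qed.

(** The left side is the trace of Y -> C Y D on all matrices. With the next lemma, on Y -> C
    theta(Y) D, it covers the two halves of [P]. *)
Lemma sum_frame_mul C D :
  \sum_a \sum_b (C *m delta_mx a b *m D) a b = \tr C * \tr D.
Proof.
under eq_bigr do under eq_bigr do rewrite mul_delta_mx_entry.
by under eq_bigr do rewrite -mulr_sumr; rewrite -mulr_suml.
Qed.

Lemma sum_frame_symp_adj C D :
  \sum_a \sum_b (C *m theta (delta_mx a b) *m D) a b = - \tr (C *m theta D).
Proof.
have E a b : (C *m theta (delta_mx a b) *m D) a b = (C *m J) a b * (J *m D) a b.
  by rewrite /theta trmx_delta !mulmxA -(mulmxA _ J D) mul_delta_mx_entry.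
under eq_bigr do under eq_bigr do rewrite E.
rewrite /theta -[LHS]/(\sum_a \sum_b _) -linearN /=.
rewrite -mulmxN -mulmxN -J_anti -mulmxA -trmx_mul mulmxA.
by apply: eq_bigr => a _; rewrite mxE; apply: eq_bigr => b _; rewrite [X in _ = _ * X]mxE.
Qed.

(** ad A ad B is a sum of four maps Y -> C Y D up to sign. The identity half of [P] contributes 2m
    tr(AB), as tr A = tr B = 0, and the [theta] half tr(AB) for each of the four maps; the factor
    2^-1 of [P] leaves m + 2. *)
Lemma sum_frame_ad_ad A B : theta A = A -> theta B = B ->
  \sum_a \sum_b (A *m (B *m P (delta_mx a b) - P (delta_mx a b) *m B)
     - (B *m P (delta_mx a b) - P (delta_mx a b) *m B) *m A) a b
  = (m + 2)%:R * \tr (A *m B).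
Proof.
move=> hA hB.
pose U (Y : 'M[R]_m) := A *m B *m Y *m 1%:M - A *m Y *m B - B *m Y *m A + 1%:M *m Y *m (B *m A).
have E a b : (A *m (B *m P (delta_mx a b) - P (delta_mx a b) *m B)
     - (B *m P (delta_mx a b) - P (delta_mx a b) *m B) *m A)
   = 2^-1 *: (U (delta_mx a b) + U (theta (delta_mx a b))).
  rewrite /P /U !(mulmx1, mul1mx) -!(scalemxAl, scalemxAr) -!scalerBr.
  rewrite -!(scalemxAl, scalemxAr) -!scalerBr; congr (_ *: _).
  set Y := theta (delta_mx a b); set Z := delta_mx a b; move: Y Z => Y Z.
  rewrite !(opprD, mulmxDl, mulmxDr, mulmxN, mulNmx, mulmxA, opprK).
  by apply/matrixP => i j; rewrite !mxE; ring.
under eq_bigr do under eq_bigr do rewrite E mxE mxE.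
under eq_bigr do rewrite -mulr_sumr big_split /=.
rewrite -mulr_sumr big_split /=.
have F (h : 'M[R]_m -> 'M[R]_m) : \sum_a \sum_b U (h (delta_mx a b)) a b =
   \sum_a \sum_b (A *m B *m h (delta_mx a b) *m 1%:M) a b
   - \sum_a \sum_b (A *m h (delta_mx a b) *m B) a b
   - \sum_a \sum_b (B *m h (delta_mx a b) *m A) a b
   + \sum_a \sum_b (1%:M *m h (delta_mx a b) *m (B *m A)) a b.
  rewrite -!sumrB -big_split; apply: eq_bigr => a _ /=.
  by rewrite -!sumrB -big_split; apply: eq_bigr => b _ /=; rewrite /U !mxE.
rewrite (F id) (F theta) !sum_frame_mul !sum_frame_symp_adj.
have theta1 : theta 1%:M = - 1%:M by rewrite /theta trmx1 mulmx1 J_sqr.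
rewrite symp_adjM theta1 hA hB !(mxtrace_symp hA) !(mxtrace_symp hB) mul1mx mxtrace1.
rewrite !mulmxN mulmx1 !linearN /= (mxtrace_mulC B A) natrD.
by field.
Qed.

End SymplecticInvolution.

(** * Killing form and Casimir tensor of a Lie algebra of fields modelled on symplectic matrices *)

Section LinearModel.
Variables (R : realType) (m d : nat) (J : 'M[R]_m).
Hypothesis J_anti : J^T = - J.
Hypothesis J_sqr : J *m J = - 1%:M.
Local Notation theta := (symp_adj J).
Local Notation P := (symp_proj J).
Local Notation VF := (vector_field R d).
Implicit Types A B C D : 'M[R]_m.

Variables (g : set VF) (Phi : {linear 'M[R]_m -> VF}).
Hypothesis gE : g = [set Phi A | A in [set A | theta A = A]].
Hypothesis Phi_inj : forall A, theta A = A -> Phi A = 0 -> A = 0.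
Hypothesis Phi_bracket : forall A B,
  lie_bracket (Phi A) (Phi B) = Phi (A *m B - B *m A).

Section Basis.
Variables (N : nat) (b : 'I_N -> VF).
Hypothesis b_basis : is_basis g b.

Lemma coords_eq Z (c : 'rV[R]_N) : Z = \sum_a c 0 a *: b a -> coords b Z = c.
Proof.
move=> Zc; rewrite /coords; case: xgetP => [c' _ Zc'|/(_ c) //].
have [free _] := b_basis; apply/eqP; rewrite -subr_eq0; apply/eqP; apply: free.
under eq_bigr do rewrite !mxE scalerBl.
by rewrite sumrB -Zc' -Zc subrr.
Qed.

Lemma coordsE Z : g Z -> Z = \sum_a coords b Z 0 a *: b a.
Proof. by have [_ ->] := b_basis; case=> c Zc; rewrite (coords_eq Zc). Qed.

Lemma model_mem A : theta A = A -> g (Phi A).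
Proof. by move=> hA; rewrite gE; exists A. Qed.

Lemma coords_linear (I : finType) (r : I -> R) (Z : I -> VF) :
  (forall i, g (Z i)) ->
  coords b (\sum_i r i *: Z i) = \sum_i r i *: coords b (Z i).
Proof.
move=> gZ; apply: coords_eq.
under eq_bigr do rewrite {1}(coordsE (gZ _)) scaler_sumr.
rewrite exchange_big; apply: eq_bigr => a _ /=.
rewrite summxE scaler_suml; apply: eq_bigr => i _.
by rewrite scalerA mxE.
Qed.

Lemma model_basis : exists B : 'I_N -> 'M[R]_m,
  forall i, theta (B i) = B i /\ b i = Phi (B i).
Proof.
suff /choice [B hB] : forall i, exists B, theta B = B /\ b i = Phi B by exists B.
move=> i; have : g (b i).
  have [_ ->] := b_basis; exists (delta_mx 0 i).
  rewrite (bigD1 i) //= !mxE !eqxx scale1r big1 ?addr0 // => j /negPf ji.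
  by rewrite mxE ji andbF scale0r.
by rewrite gE => -[B hB <-]; exists B.
Qed.

Lemma model_basisE (B : 'I_N -> 'M[R]_m) A :
  (forall i, theta (B i) = B i /\ b i = Phi (B i)) -> theta A = A ->
  A = \sum_i coords b (Phi A) 0 i *: B i.
Proof.
move=> hB hA; apply/eqP; rewrite -subr_eq0; apply/eqP; apply: Phi_inj.
  rewrite linearB /= hA linear_sum /=; congr (_ - _); apply: eq_bigr => i _.
  by rewrite linearZ /= (hB i).1.
rewrite linearB /= {1}(coordsE (model_mem hA)) linear_sum /=.
apply/eqP; rewrite subr_eq0; apply/eqP; apply: eq_bigr => i _.
by rewrite linearZ /= (hB i).2.
Qed.

(* The matrices [P E_ij] span the symplectic algebra, with the entries as
   coefficient functionals; a trace can be computed on such a frame. *)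
Lemma trace_frame (f : VF -> VF) (F : {linear 'M[R]_m -> 'M[R]_m}) :
  (forall A, theta A = A -> theta (F A) = F A /\ f (Phi A) = Phi (F A)) ->
  \tr (matrix_in b f) = \sum_i \sum_j F (P (delta_mx i j)) i j.
Proof.
move=> hF; have [B hB] := model_basis.
have hP i j : theta (P (delta_mx i j)) = P (delta_mx i j) by exact: symp_adj_proj.
(* As [B k] is fixed by [P], it combines the frame matrices with its own entries as coefficients.
   Summing over k first then reassembles F(P E_ij) from its coordinates, and its (i,j) entry is
   left. *)
transitivity (\sum_k \sum_i \sum_j
    B k i j * coords b (Phi (F (P (delta_mx i j)))) 0 k).
  apply: eq_bigr => k _; rewrite mxE (hB k).2 (hF _ (hB k).1).2.
  have -> : Phi (F (B k)) =
      \sum_(p : 'I_m * 'I_m) B k p.1 p.2 *: Phi (F (P (delta_mx p.1 p.2))).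
    rewrite -{1}(symp_proj_id (hB k).1) {1}[B k]matrix_sum_delta pair_big /=.
    rewrite !linear_sum /=; apply: eq_bigr => p _.
    by rewrite [P _]linearZ /= [F _]linearZ /= linearZ.
  have /(coords_linear (fun p : 'I_m * 'I_m => B k p.1 p.2)) lin :
      forall p : 'I_m * 'I_m, g (Phi (F (P (delta_mx p.1 p.2)))).
    by move=> p; apply: model_mem; exact: (hF _ _).1.
  rewrite [coords _ _]lin summxE pair_big /=.
  by apply: eq_bigr => p _; rewrite mxE.
rewrite exchange_big; apply: eq_bigr => i _ /=.
rewrite exchange_big; apply: eq_bigr => j _ /=.
rewrite [in RHS](model_basisE hB (hF _ (hP i j)).1) summxE.
by apply: eq_bigr => k _; rewrite mxE mulrC.
Qed.

End Basis.

Lemma trace_onE (N : nat) (b : 'I_N -> VF) (f : VF -> VF)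
    (F : {linear 'M[R]_m -> 'M[R]_m}) :
  is_basis g b ->
  (forall A, theta A = A -> theta (F A) = F A /\ f (Phi A) = Phi (F A)) ->
  trace_on g f = \sum_i \sum_j F (P (delta_mx i j)) i j.
Proof.
(* Every candidate value equals the frame sum, and [b] provides a candidate, so the default value of
   [xget] is never taken. *)
move=> b_basis hF; rewrite /trace_on; case: xgetP => [tau _|].
  case=> N' [b' [b'_basis ->]]. exact: (trace_frame b'_basis hF).
move=> /(_ (\tr (matrix_in b f))); case; exists N, b; split => //.
Qed.

Lemma killing_model (N : nat) (b : 'I_N -> VF) A B :
  is_basis g b -> theta A = A -> theta B = B ->
  killing g (Phi A) (Phi B) = (m + 2)%:R * \tr (A *m B).
Proof.
move=> b_basis hA hB.
pose F := (fun X => A *m (B *m X - X *m B) - (B *m X - X *m B) *m A).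
have F_lin : linear F.
  move=> r X Y; rewrite /F; apply/matrixP => i j.
  rewrite !(mulmxDl, mulmxDr, mulmxBl, mulmxBr, mulmxN, mulNmx, mulmxA, =^~ scalemxAl, =^~ scalemxAr).
  by rewrite !mxE; ring.
pose FL : {linear 'M[R]_m -> 'M[R]_m} := HB.pack F
  (GRing.isLinear.Build R 'M[R]_m 'M[R]_m _ F F_lin).
rewrite /killing (@trace_onE _ b _ FL) //; last first.
  move=> X hX; split => /=; last by rewrite !Phi_bracket.
  by apply: symp_commutator => //; exact: symp_commutator.
exact: sum_frame_ad_ad.
Qed.

(* The Casimir tensor [sum_c b_c (x) b_c^*] does not depend on the basis. *)
Lemma dual_basis_tensor (N : nat) (b bstar : 'I_N -> VF) :
  is_basis g b -> is_dual_basis g b bstar ->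
  exists B Bstar : 'I_N -> 'M[R]_m,
  [/\ forall c, b c = Phi (B c), forall c, bstar c = Phi (Bstar c) &
   forall i j k l, \sum_c B c i j * Bstar c k l
     = (m + 2)%:R^-1 * P (delta_mx l k) i j].
Proof.
move=> b_basis [gbstar dual].
have [B hB] := model_basis b_basis.
have /choice [Bs hBs] : forall i, exists B, theta B = B /\ bstar i = Phi B.
  by move=> i; have := gbstar i; rewrite gE => -[B' hB' <-]; exists B'.
exists B, Bs; split=> [c|c|i j k l]; [exact: (hB c).2|exact: (hBs c).2|].
have m2 : (m + 2)%:R != 0 :> R by rewrite pnatr_eq0 addn2.
have hP : theta (P (delta_mx l k)) = P (delta_mx l k) by exact: symp_adj_proj.
have BBs c e : \tr (B c *m Bs e) = (m + 2)%:R^-1 * (c == e)%:R.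
  rewrite -dual (hB c).2 (hBs e).2 (killing_model b_basis (hB c).1 (hBs e).1).
  by rewrite mulKf.
(* Pairing with the dual basis reads off coordinates, up to the factor m + 2 of the Killing form.
   Since tr(E_lk Y) is the entry Y_kl, the indices k and l are exchanged in the tensor. *)
have cE c : coords b (Phi (P (delta_mx l k))) 0 c = (m + 2)%:R * Bs c k l.
  have <- : \tr (P (delta_mx l k) *m Bs c) = Bs c k l.
    rewrite mxtrace_proj_mul // (symp_proj_id (hBs c).1).
    rewrite /mxtrace (bigD1 l) //= big1 ?addr0 => [|a /negPf al].
      rewrite mxE (bigD1 k) //= !mxE !eqxx mul1r big1 ?addr0 // => e /negPf ek.
      by rewrite mxE ek andbF mul0r.
    by rewrite mxE big1 // => e _; rewrite mxE al mul0r.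
  rewrite {2}(model_basisE b_basis hB hP) mulmx_suml linear_sum /=.
  under eq_bigr do rewrite -scalemxAl mxtraceZ BBs.
  rewrite (bigD1 c) //= eqxx mulr1 big1 ?addr0 => [|e /negPf ->].
    by rewrite mulrCA mulfV ?mulr1.
  by rewrite !mulr0.
rewrite (model_basisE b_basis hB hP) summxE mulr_sumr; apply: eq_bigr => c _.
by rewrite mxE cE mulrA mulrA mulVf // mul1r mulrC.
Qed.

End LinearModel.

(** * Projective vector fields *)

Section ProjectiveFields.
Variables (R : realType) (d : nat).
Local Notation F := ('rV[R]_d -> R).
Implicit Types (A B : 'M[R]_(d + 1)) (i j : 'I_d) (x : 'rV[R]_d).

Definition lin i : 'I_(d + 1) := lshift 1 i.
Definition tau_idx : 'I_(d + 1) := rshift d ord0.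

Definition hat x : 'rV[R]_(d + 1) := row_mx x (1%:M : 'M[R]_1).

Definition hat_coord (a : 'I_(d + 1)) : F := fun x => hat x 0 a.

(* The linear field [z |-> z A] of homogeneous coordinates, in the chart where
   the tau_idx coordinate is 1. *)
Definition projective_field A : vector_field R d := fun x =>
  \row_i ((hat x *m A) 0 (lin i) - x 0 i * (hat x *m A) 0 tau_idx).

(** The c-th coordinate of z A on the chart, written as a sum of products of smooth functions so
    that the derivation rules apply. *)
Definition row_fun A c : F := \sum_a cst (A a c) * hat_coord a.

Lemma sum_hat (V : nmodType) (G : 'I_(d + 1) -> V) :
  \sum_a G a = \sum_i G (lin i) + G tau_idx.
Proof. by rewrite big_split_ord big_ord1. Qed.

Lemma hat_coord_lin i : hat_coord (lin i) = coordinate i.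
Proof. by apply/funext => x; rewrite /hat_coord row_mxEl. Qed.

Lemma hat_coord_last : hat_coord tau_idx = cst 1.
Proof. by apply/funext => x; rewrite /hat_coord row_mxEr mxE. Qed.

Lemma smooth_hat_coord a : smooth (hat_coord a).
Proof.
by case: (split_ordP a) => [i|i] ->; rewrite ?(ord1 i)
  -/(lin _) -/tau_idx ?hat_coord_lin ?hat_coord_last;
  [exact: smooth_coordinate|exact: smooth_cst].
Qed.

Lemma partial_hat_coord i a : partial_deriv i (hat_coord a) = cst (lin i == a)%:R.
Proof.
case: (split_ordP a) => [j|j] ->; rewrite ?(ord1 j).
  by rewrite -/(lin j) hat_coord_lin partial_deriv_coordinate (inj_eq (@lshift_inj _ _)).
by rewrite -/tau_idx hat_coord_last partial_deriv_cst eq_lrshift.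
Qed.

Lemma row_funE A c x : row_fun A c x = (hat x *m A) 0 c.
Proof.
by rewrite /row_fun fct_sumE mxE; apply: eq_bigr => a _; rewrite mulrC.
Qed.

Lemma smooth_row_fun A c : smooth (row_fun A c).
Proof.
by apply: smooth_sum => a _; apply: smoothM; [exact: smooth_cst|exact: smooth_hat_coord].
Qed.

Lemma partial_row_fun j A c : partial_deriv j (row_fun A c) = cst (A (lin j) c).
Proof.
rewrite /row_fun partial_deriv_sum => [|a]; last first.
  by apply: smoothM; [exact: smooth_cst|exact: smooth_hat_coord].
apply/funext => x; rewrite fct_sumE (bigD1 (lin j)) //= big1 ?addr0 => [|a /negPf ja].
  rewrite partial_derivM; [|exact: smooth_cst|exact: smooth_hat_coord].
  by rewrite partial_deriv_cst partial_hat_coord eqxx /= mul0r add0r !fctE mulr1.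
rewrite partial_derivM; [|exact: smooth_cst|exact: smooth_hat_coord].
by rewrite partial_deriv_cst partial_hat_coord eq_sym ja mul0r add0r !fctE mulr0.
Qed.

Lemma component_projective A i : component (projective_field A) i
  = row_fun A (lin i) - coordinate i * row_fun A tau_idx.
Proof. by apply/funext => x; rewrite /component mxE !fctE !row_funE. Qed.

Lemma partial_component j A i : partial_deriv j (component (projective_field A) i)
  = cst (A (lin j) (lin i)) - cst (j == i)%:R * row_fun A tau_idx
    - coordinate i * cst (A (lin j) tau_idx).
Proof.
have SM : smooth (coordinate i * row_fun A tau_idx).
  by apply: smoothM; [exact: smooth_coordinate|exact: smooth_row_fun].
rewrite component_projective partial_derivD ?partial_derivN ?partial_derivM //.
- by rewrite !partial_row_fun partial_deriv_coordinate opprD addrA.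
- exact: smooth_coordinate.
- exact: smooth_row_fun.
- exact: smooth_row_fun.
- exact: smoothN.
Qed.

Lemma projective_fieldE A x i : projective_field A x 0 i =
  (hat x *m A) 0 (lin i) - x 0 i * (hat x *m A) 0 tau_idx.
Proof. by rewrite mxE. Qed.

Lemma hatE_lin x i : hat x 0 (lin i) = x 0 i.
Proof. by rewrite row_mxEl. Qed.

Lemma hatE_last x : hat x 0 tau_idx = 1.
Proof. by rewrite row_mxEr mxE. Qed.

Lemma projective_field_is_linear : linear projective_field.
Proof.
move=> r A B; apply/funext => x; apply/rowP => i.
transitivity (r * projective_field A x 0 i + projective_field B x 0 i).
  rewrite !projective_fieldE mulmxDr -scalemxAr.
  by rewrite ![fun_of_matrix (_ + _) _ _]mxE ![fun_of_matrix (_ *: _) _ _]mxE; ring.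
by rewrite [RHS]mxE [X in _ = X + _]mxE.
Qed.
HB.instance Definition _ := GRing.isLinear.Build R 'M[R]_(d + 1)
  (vector_field R d) _ projective_field projective_field_is_linear.

(** The differential of z -> z/z_tau at z_tau = 1 subtracts the multiple of z that makes the vector
    tangent to the chart. *)
Lemma hat_projective_field A x :
  row_mx (projective_field A x) 0 = hat x *m A - (hat x *m A) 0 tau_idx *: hat x.
Proof.
apply/rowP => a; rewrite [RHS]mxE [X in _ + X]mxE [X in _ - X]mxE.
case: (split_ordP a) => [j|j] ->; rewrite ?(ord1 j).
  by rewrite row_mxEl projective_fieldE -/(lin j) hatE_lin mulrC.
by rewrite row_mxEr -/tau_idx hatE_last mxE mulr1 subrr.
Qed.

Lemma sum_projective_field A B x c :
  \sum_j projective_field A x 0 j * B (lin j) c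
  = (hat x *m A *m B) 0 c - (hat x *m A) 0 tau_idx * (hat x *m B) 0 c.
Proof.
have := congr1 (fun r : 'rV_(d + 1) => (r *m B) 0 c) (hat_projective_field A x).
rewrite /= mulmxBl -scalemxAl [RHS]mxE [X in _ + X]mxE [X in _ - X]mxE => <-.
rewrite mxE sum_hat row_mxEr mxE mul0r addr0.
by apply: eq_bigr => j _; rewrite row_mxEl.
Qed.

(** Matrices act on row vectors from the right: the derivative of z B along z A is z A B, so A -> z
    A preserves brackets without a sign. *)
Lemma bracket_projective A B : lie_bracket (projective_field A) (projective_field B)
  = projective_field (A *m B - B *m A).
Proof.
have apply_comp A1 B1 i x :
    vf_apply (projective_field A1) (component (projective_field B1) i) x =
    (hat x *m A1 *m B1) 0 (lin i) - (hat x *m A1) 0 tau_idx * (hat x *m B1) 0 (lin i)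
    - x 0 i * ((hat x *m A1 *m B1) 0 tau_idx - (hat x *m A1) 0 tau_idx * (hat x *m B1) 0 tau_idx)
    - ((hat x *m A1) 0 (lin i) - x 0 i * (hat x *m A1) 0 tau_idx) * (hat x *m B1) 0 tau_idx.
  rewrite -!sum_projective_field -projective_fieldE /vf_apply fct_sumE.
  transitivity (\sum_j (projective_field A1 x 0 j * B1 (lin j) (lin i)
    - x 0 i * (projective_field A1 x 0 j * B1 (lin j) tau_idx)
    - (if j == i then projective_field A1 x 0 j * (hat x *m B1) 0 tau_idx else 0))).
    apply: eq_bigr => j _; rewrite partial_component !fctE row_funE /component.
    by rewrite /coordinate; case: (j == i) => /=; ring.
  by rewrite !sumrB -mulr_sumr -big_mkcond big_pred1_eq.
apply/funext => x; apply/rowP => i; rewrite [LHS]mxE !apply_comp projective_fieldE.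
rewrite mulmxBr !mulmxA ![fun_of_matrix (_ - _) _ _]mxE ![fun_of_matrix (- _) _ _]mxE.
ring.
Qed.

(** Only scalar matrices preserve every line through the origin, and trace zero excludes those other
    than 0. Symplectic matrices satisfy this condition by [mxtrace_symp]. *)
Lemma projective_field_eq0 A : projective_field A = 0 -> \tr A = 0 -> A = 0.
Proof.
move=> A0 trA.
have E x i : (hat x *m A) 0 (lin i) = x 0 i * (hat x *m A) 0 tau_idx.
  by apply/eqP; rewrite -subr_eq0 -projective_fieldE A0 mxE.
have row_hat x c : (hat x *m A) 0 c = \sum_j x 0 j * A (lin j) c + A tau_idx c.
  rewrite mxE sum_hat hatE_last mul1r; congr (_ + _).
  by apply: eq_bigr => j _; rewrite hatE_lin.
have A_last i : A tau_idx (lin i) = 0.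
  have := E 0 i; rewrite row_hat mxE mul0r big1 ?add0r // => j _.
  by rewrite mxE mul0r.
have row_basis r j c : (hat (r *: 'e_j) *m A) 0 c = r * A (lin j) c + A tau_idx c.
  rewrite row_hat (bigD1 j) //= big1 ?addr0 => [|l /negPf lj].
    by rewrite !mxE !eqxx mulr1.
  by rewrite !mxE lj andbF mulr0 mul0r.
have E2 r j i : r * A (lin j) (lin i) =
    (r * (j == i)%:R) * (r * A (lin j) tau_idx + A tau_idx tau_idx).
  have := E (r *: 'e_j) i; rewrite !row_basis A_last addr0 => ->.
  by rewrite !mxE eqxx /= eq_sym.
(* The relation [E2] is quadratic in r; the values 1 and -1 separate its quadratic coefficient from
   the linear one. *)
have A_lin_last j : A (lin j) tau_idx = 0.
  have := E2 1 j j; have := E2 (-1) j j; rewrite !eqxx /= !mulr1 !mul1r => h1 h2; lra.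
have A_lin i j : A (lin i) (lin j) = (i == j)%:R * A tau_idx tau_idx.
  by have := E2 1 i j; rewrite !mul1r A_lin_last add0r.
have Al : A tau_idx tau_idx = 0.
  move: trA; rewrite /mxtrace sum_hat.
  under eq_bigr do rewrite A_lin eqxx mul1r.
  rewrite sumr_const card_ord -mulrSr => /eqP; rewrite mulrn_eq0 /= => /eqP //.
apply/matrixP => a c; rewrite mxE.
case: (split_ordP a) => [i|i] ->; case: (split_ordP c) => [j|j] ->;
  rewrite ?(ord1 i) ?(ord1 j) -?/(lin _) -?/tau_idx;
  by rewrite ?A_lin ?A_last ?A_lin_last ?Al ?mulr0.
Qed.

End ProjectiveFields.

(** * Polynomials of degree at most 2 as quadratic forms in homogeneous coordinates *)

Section Quadratic.
Variables (R : realType) (d : nat).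
Implicit Types (M : 'M[R]_(d + 1)) (x : 'rV[R]_d) (h : mpoly d R).

(** Only the Hessian [M + M^T] matters. Leaving [M] arbitrary lets a monomial be represented by a
    single [delta_mx]. *)
Definition quadratic M : 'rV[R]_d -> R :=
  \sum_a hat_coord a * row_fun M^T a.

Lemma quadraticE M x :
  quadratic M x = \sum_a \sum_b M a b * (hat x 0 a * hat x 0 b).
Proof.
rewrite /quadratic fct_sumE; apply: eq_bigr => a _.
rewrite !fctE row_funE mxE mulr_sumr; apply: eq_bigr => b _.
by rewrite [M^T _ _]mxE /hat_coord; ring.
Qed.

Lemma partial_quadratic M i :
  partial_deriv i (quadratic M) = row_fun (M + M^T) (lin i).
Proof.
rewrite /quadratic partial_deriv_sum => [|a]; last first.
  by apply: smoothM; [exact: smooth_hat_coord|exact: smooth_row_fun].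
apply/funext => x; rewrite fct_sumE row_funE mulmxDr [RHS]mxE -!row_funE.
rewrite (eq_bigr (fun a => (lin i == a)%:R * row_fun M^T a x + hat x 0 a * M a (lin i))).
  rewrite big_split /= (bigD1 (lin i)) //= eqxx mul1r big1 ?addr0 => [|a /negPf ia].
    by rewrite addrC; congr (_ + _); rewrite row_funE [RHS]mxE.
  by rewrite eq_sym ia mul0r.
move=> a _; rewrite partial_derivM; [|exact: smooth_hat_coord|exact: smooth_row_fun].
by rewrite partial_hat_coord partial_row_fun [M^T _ _]mxE.
Qed.

(** Euler's identity in degree 2, including the derivative along [tau]. It turns the term 2h of the
    contact field into first derivatives. *)
Lemma double_quadratic M x : 2 * quadratic M x = \sum_a hat x 0 a * row_fun (M + M^T) a x.
Proof.
rewrite mulr_natl mulr2n {1}quadraticE exchange_big /= quadraticE -big_split /=.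
apply: eq_bigr => a _; rewrite row_funE [fun_of_matrix (_ *m _) _ _]mxE mulr_sumr -big_split /=.
by apply: eq_bigr => b _; rewrite [(M + M^T) _ _]mxE [M^T _ _]mxE; ring.
Qed.

Lemma quadraticD M1 M2 x : quadratic (M1 + M2) x = quadratic M1 x + quadratic M2 x.
Proof.
rewrite !quadraticE -big_split; apply: eq_bigr => a _ /=.
by rewrite -big_split; apply: eq_bigr => b _ /=; rewrite [(M1 + M2) _ _]mxE mulrDl.
Qed.

Lemma quadraticZ r M x : quadratic (r *: M) x = r * quadratic M x.
Proof.
rewrite !quadraticE mulr_sumr; apply: eq_bigr => a _.
by rewrite mulr_sumr; apply: eq_bigr => b _; rewrite [(r *: M) _ _]mxE -mulrA.
Qed.

Lemma quadratic_delta a b x : quadratic (delta_mx a b) x = hat x 0 a * hat x 0 b.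
Proof.
rewrite quadraticE (bigD1 a) //= [X in _ + X]big1 ?addr0 => [|c /negPf ca]; last first.
  by rewrite big1 // => e _; rewrite [delta_mx _ _ _ _]mxE ca mul0r.
rewrite (bigD1 b) //= big1 ?addr0 => [|e /negPf eb].
  by rewrite [delta_mx _ _ _ _]mxE !eqxx mul1r.
by rewrite [delta_mx _ _ _ _]mxE eb andbF mul0r.
Qed.

Definition hat_mnm (a : 'I_(d + 1)) : multinom d :=
  match fintype.split a with inl i => mnm1 i | inr _ => mnm0 end.

Lemma hat_mnm_lin i : hat_mnm (lin i) = mnm1 i.
Proof. by rewrite /hat_mnm /lin -[lshift 1 i]/(unsplit (inl i)) unsplitK. Qed.

Lemma hat_mnm_last : hat_mnm (tau_idx d) = mnm0.
Proof. by rewrite /hat_mnm /tau_idx -[rshift d ord0]/(unsplit (inr ord0)) unsplitK. Qed.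

Lemma mdeg_hat_mnm a : (mdeg (hat_mnm a) <= 1)%N.
Proof. by rewrite /hat_mnm; case: (fintype.split a) => i; rewrite ?mdeg1 ?mdeg0. Qed.

Lemma meval_hat_mnm a x : meval (x 0) (mpolyX R (hat_mnm a)) = hat x 0 a.
Proof.
case: (split_ordP a) => [i|i] ->; rewrite ?(ord1 i).
  by rewrite -/(lin i) hat_mnm_lin mevalXU hatE_lin.
by rewrite -/(tau_idx d) hat_mnm_last mpolyX0 meval1 hatE_last.
Qed.

(** Homogenisation: a monomial of degree less than 2 is completed by factors [tau], whose monomial
    is 1. *)
Lemma mnm_le2 (m : multinom d) : (mdeg m <= 2)%N ->
  exists a b, m = mnm_add (hat_mnm a) (hat_mnm b).
Proof.
have step (m' : multinom d) k : (mdeg m' <= k.+1)%N ->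
    exists a m2, m' = mnm_add (hat_mnm a) m2 /\ (mdeg m2 <= k)%N.
  move=> mk; have [m0|] := eqVneq (mdeg m') 0%N.
    exists (tau_idx d), m'; rewrite hat_mnm_last add0m m0; split=> //.
  rewrite mdeg_eq0 => /eqP m0.
  have [i mi] : exists i, (0 < m' i)%N.
    apply/existsP; apply: contra_notT m0 => /existsPn h; apply/mnmP => i.
    by have := h i; rewrite -eqn0Ngt mnm0E => /eqP.
  exists (lin i), (mnm_sub m' (mnm1 i)); rewrite hat_mnm_lin.
  have E : m' = mnm_add (mnm1 i) (mnm_sub m' (mnm1 i)).
    apply/mnmP => j; rewrite mnmDE mnmBE mnm1E.
    by case: eqP => [<-|_] /=; [rewrite subnKC|rewrite subn0].
  by split=> //; move: mk; rewrite {1}E mdegD mdeg1.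
move=> /step [a [m2 [-> /step [b [m3 [-> ]]]]]].
by rewrite leqn0 mdeg_eq0 => /eqP ->; exists a, b; rewrite addm0.
Qed.

Lemma quadratic_of_mpoly h : (msize h <= 3)%N ->
  exists M, (fun x => meval (x 0) h) = quadratic M.
Proof.
move=> h3.
have mono m : exists M, m \in msupp h -> forall x, meval (x 0) (mpolyX R m) = quadratic M x.
  have [mh|] := boolP (m \in msupp h); last by exists 0.
  have /mnm_le2 [a [b ->]] : (mdeg m <= 2)%N.
    by rewrite -ltnS; exact: leq_trans (msize_mdeg_lt mh) h3.
  by exists (delta_mx a b) => _ x; rewrite mpolyXD mevalM !meval_hat_mnm quadratic_delta.
have [M hM] := choice mono.
exists (\sum_(m <- msupp h) mcoeff m h *: M m); apply/funext => x.
rewrite [h in LHS]mpolyE raddf_sum /= big_seq.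
rewrite (eq_bigr (fun m => quadratic (mcoeff m h *: M m) x)) => [|m mh]; last first.
  by rewrite mevalZ hM // quadraticZ.
rewrite -big_seq; elim: (msupp h : seq _) => [|m s IH].
  by rewrite !big_nil -(scale0r (0 : 'M[R]_(d + 1))) quadraticZ mul0r.
by rewrite !big_cons quadraticD IH.
Qed.

Lemma mpoly_of_quadratic M : exists h,
  (msize h <= 3)%N /\ quadratic M = (fun x => meval (x 0) h).
Proof.
exists (\sum_a \sum_b M a b *: mpolyX R (mnm_add (hat_mnm a) (hat_mnm b))).
split; last first.
  apply/funext => x; rewrite quadraticE raddf_sum; apply: eq_bigr => a _ /=.
  rewrite raddf_sum; apply: eq_bigr => b _ /=.
  by rewrite mevalZ mpolyXD mevalM !meval_hat_mnm.
apply: (leq_trans (mmeasure_sum _ _ _ _)); apply/bigmax_leqP => a _.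
apply: (leq_trans (mmeasure_sum _ _ _ _)); apply/bigmax_leqP => b _.
apply: (leq_trans (mmeasureZ_le _ _ _)); rewrite mmeasureX ltnS /= mdegD.
exact: (@leq_add _ _ 1 1 (mdeg_hat_mnm a) (mdeg_hat_mnm b)).
Qed.

End Quadratic.

(** * Contact fields *)

Section ContactModel.
Variables (R : realType) (n : nat).
Local Notation d := (cdim n).
Local Notation idx := 'I_(d + 1).
Local Notation lp k := (lin (ip k)).
Local Notation lq k := (lin (iq k)).
Local Notation lt := (lin (it n)).
Local Notation tau := (tau_idx d).

(* Exchanges p_k with q^k, and t with the extra homogeneous coordinate. *)
Definition star (a : idx) : idx :=
  match fintype.split a with
  | inl i => match fintype.split i with
    | inl j => match fintype.split j with inl k => lq k | inr k => lp k end
    | inr _ => tau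
    end
  | inr _ => lt
  end.

(** With these signs t and [tau] form one more conjugate pair beside the (p_k, q^k), so [Jmx] is a
    standard symplectic matrix. *)
Definition sgn (a : idx) : R :=
  match fintype.split a with
  | inl i => match fintype.split i with
    | inl j => match fintype.split j with inl k => 1 | inr k => -1 end
    | inr _ => 1
    end
  | inr _ => -1
  end.

Lemma split_lshift p q (i : 'I_p) : fintype.split (lshift q i) = inl i.
Proof. by rewrite -[lshift _ _]/(unsplit (inl i)) unsplitK. Qed.

Lemma split_rshift p q (i : 'I_q) : fintype.split (rshift p i) = inr i.
Proof. by rewrite -[rshift _ _]/(unsplit (inr i)) unsplitK. Qed.

Definition splitE := (split_lshift, split_rshift).

Lemma star_p k : star (lp k) = lq k. Proof. by rewrite /star !splitE. Qed.
Lemma star_q k : star (lq k) = lp k. Proof. by rewrite /star !splitE. Qed.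
Lemma star_t : star lt = tau. Proof. by rewrite /star !splitE. Qed.
Lemma star_last : star tau = lt. Proof. by rewrite /star !splitE. Qed.
Lemma sgn_p k : sgn (lp k) = 1. Proof. by rewrite /sgn !splitE. Qed.
Lemma sgn_q k : sgn (lq k) = -1. Proof. by rewrite /sgn !splitE. Qed.
Lemma sgn_t : sgn lt = 1. Proof. by rewrite /sgn !splitE. Qed.
Lemma sgn_last : sgn tau = -1. Proof. by rewrite /sgn !splitE. Qed.

Definition starE := (star_p, star_q, star_t, star_last).
Definition sgnE := (sgn_p, sgn_q, sgn_t, sgn_last).

Lemma dim_ind (Q : 'I_d -> Prop) :
  (forall k, Q (ip k)) -> (forall k, Q (iq k)) -> Q (it n) -> forall i, Q i.
Proof.
move=> hp hq ht i; case: (split_ordP i) => [j|j] ->; last by rewrite (ord1 j).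
by case: (split_ordP j) => k ->; [exact: hp|exact: hq].
Qed.

Lemma idx_ind (Q : idx -> Prop) : (forall k, Q (lp k)) -> (forall k, Q (lq k)) ->
  Q lt -> Q tau -> forall a, Q a.
Proof.
move=> hp hq ht hl a; case: (split_ordP a) => [i|i] ->; last by rewrite (ord1 i).
exact: (dim_ind (Q := fun i => Q (lin i))).
Qed.

Lemma starK : involutive star.
Proof. by apply: idx_ind => [k|k||]; rewrite !starE. Qed.

Lemma sgn_star a : sgn (star a) = - sgn a.
Proof. by elim/idx_ind: a => [k|k||]; rewrite !starE !sgnE ?opprK. Qed.

Lemma sgn_sqr a : sgn a * sgn a = 1.
Proof. by elim/idx_ind: a => [k|k||]; rewrite !sgnE ?mulrNN mulr1. Qed.

Definition Jmx : 'M[R]_(d + 1) := \matrix_(a, b) (sgn a * (b == star a)%:R).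

Lemma mulmxJ m (A : 'M[R]_(m, d + 1)) i b : (A *m Jmx) i b = A i (star b) * sgn (star b).
Proof.
rewrite mxE (bigD1 (star b)) //= mxE starK eqxx mulr1 big1 ?addr0 // => a ab.
by rewrite mxE eq_sym -(inj_eq (inv_inj starK)) starK (negPf ab) !mulr0.
Qed.

Lemma mulJmx m (A : 'M[R]_(d + 1, m)) a j : (Jmx *m A) a j = sgn a * A (star a) j.
Proof.
rewrite mxE (bigD1 (star a)) //= mxE eqxx mulr1 big1 ?addr0 // => b /negPf ba.
by rewrite mxE ba mulr0 mul0r.
Qed.

Lemma J_anti : Jmx^T = - Jmx.
Proof.
apply/matrixP => a b; rewrite !mxE -(inj_eq (inv_inj starK)) starK eq_sym.
case: eqP => [->|_]; last by rewrite !mulr0 oppr0.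
by rewrite /= !mulr1 sgn_star.
Qed.

Lemma J_sqr : Jmx *m Jmx = - 1%:M.
Proof.
apply/matrixP => a b; rewrite mulJmx !mxE starK sgn_star mulrA mulrN sgn_sqr.
by rewrite mulN1r eq_sym.
Qed.

Lemma theta_delta a b : symp_adj Jmx (delta_mx a b)
  = - (sgn a * sgn b) *: delta_mx (star b) (star a).
Proof.
apply/matrixP => i j; rewrite mulmxJ mulJmx !mxE.
rewrite -[star j == a](inj_eq (inv_inj starK)) -[star i == b](inj_eq (inv_inj starK)) !starK.
rewrite andbC; case: eqP => [->|_]; last by rewrite !mulr0 mul0r.
by case: eqP => [->|_] /=; rewrite ?(mulr0, mul0r) ?starK ?sgn_star //; ring.
Qed.

Lemma sum_basis_pq (f g : 'I_n -> R) (i : 'I_d) :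
  (\sum_k (f k *: 'e_(ip k) + g k *: 'e_(iq k)) : 'rV[R]_d) 0 i =
  \sum_k (f k * (i == ip k)%:R + g k * (i == iq k)%:R).
Proof. by rewrite summxE; apply: eq_bigr => k _; rewrite !mxE !eqxx. Qed.

Lemma eq_pp k l : (@ip n k == ip l) = (k == l).
Proof. by rewrite !(inj_eq (@lshift_inj _ _)). Qed.
Lemma eq_qq k l : (@iq n k == iq l) = (k == l).
Proof. by rewrite (inj_eq (@lshift_inj _ _)) (inj_eq (@rshift_inj _ _)). Qed.
Lemma eq_pq k l : (@ip n k == iq l) = false.
Proof. by rewrite (inj_eq (@lshift_inj _ _)) eq_lrshift. Qed.
Lemma eq_qp k l : (@iq n k == ip l) = false.
Proof. by rewrite eq_sym eq_pq. Qed.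
Lemma eq_tp k : (it n == ip k) = false. Proof. by rewrite eq_rlshift. Qed.
Lemma eq_tq k : (it n == iq k) = false. Proof. by rewrite eq_rlshift. Qed.
Lemma eq_pt k : (ip k == it n) = false. Proof. by rewrite eq_lrshift. Qed.
Lemma eq_qt k : (iq k == it n) = false. Proof. by rewrite eq_lrshift. Qed.
Definition dim_eqE := (eq_pp, eq_qq, eq_pq, eq_qp, eq_tp, eq_tq, eq_pt, eq_qt).

Lemma sum_pq_p (f g : 'I_n -> R) l :
  \sum_k (f k * (ip l == ip k)%:R + g k * (ip l == iq k)%:R) = f l.
Proof.
rewrite (bigD1 l) //= !dim_eqE eqxx mulr1 mulr0 addr0 big1 ?addr0 // => k kl.
by rewrite !dim_eqE eq_sym (negPf kl) !mulr0 addr0.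
Qed.

Lemma sum_pq_q (f g : 'I_n -> R) l :
  \sum_k (f k * (iq l == ip k)%:R + g k * (iq l == iq k)%:R) = g l.
Proof.
rewrite (bigD1 l) //= !dim_eqE eqxx mulr1 mulr0 add0r big1 ?addr0 // => k kl.
by rewrite !dim_eqE eq_sym (negPf kl) !mulr0 addr0.
Qed.

Lemma sum_pq_t (f g : 'I_n -> R) :
  \sum_k (f k * (it n == ip k)%:R + g k * (it n == iq k)%:R) = 0.
Proof. by rewrite big1 // => k _; rewrite !dim_eqE !mulr0 addr0. Qed.

Lemma eulerE x i : (@euler R n) x 0 i = if i == it n then 0 else x 0 i.
Proof.
rewrite /euler sum_basis_pq; elim/dim_ind: i => [l|l|].
- by rewrite sum_pq_p dim_eqE.
- by rewrite sum_pq_q dim_eqE.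
- by rewrite sum_pq_t eqxx.
Qed.

Lemma sum_dim (V : nmodType) (G : 'I_d -> V) :
  \sum_i G i = \sum_k (G (ip k) + G (iq k)) + G (it n).
Proof. by rewrite !big_split_ord big_ord1 /= big_split. Qed.

Lemma contact_fieldE (h : 'rV[R]_d -> R) x i :
  contact_field h x 0 i
  = \sum_k (- partial_deriv (iq k) h x * (i == ip k)%:R
            + partial_deriv (ip k) h x * (i == iq k)%:R)
    + (vf_apply (@euler R n) h x - 2 * h x) * (i == it n)%:R
    - partial_deriv (it n) h x * (@euler R n) x 0 i.
Proof.
rewrite -sum_basis_pq /contact_field.
rewrite (eq_bigr (fun k => - partial_deriv (iq k) h x *: 'e_(ip k)
   + partial_deriv (ip k) h x *: 'e_(iq k))) => [|k _]; last by rewrite scaleNr addrC.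
move: (\sum_k _) (euler x) => A B.
by rewrite !mxE eqxx /=; ring.
Qed.

(** In homogeneous coordinates the contact field is the linear Hamiltonian field of the quadratic
    form: z (M + M^T) is the gradient, and J turns gradients into Hamiltonian vectors. *)
Lemma contact_field_quadratic (M : 'M[R]_(d + 1)) :
  contact_field (quadratic M) = projective_field ((M + M^T) *m Jmx).
Proof.
apply/funext => x; apply/rowP => i; rewrite projective_fieldE mulmxA !mulmxJ.
set u := hat x *m (M + M^T).
have dq j : partial_deriv j (quadratic M) x = u 0 (lin j).
  by rewrite partial_quadratic row_funE.
(* The part of the t component outside the Euler field: in E_s(h) - 2h the p and q terms of Euler's
   identity cancel and only those of t and [tau] remain. *)
have E2 : vf_apply (@euler R n) (quadratic M) x - 2 * quadratic M x
    = - (x 0 (it n) * u 0 lt + u 0 tau).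
  rewrite double_quadratic sum_hat sum_dim hatE_last mul1r row_funE -/u.
  rewrite /vf_apply fct_sumE sum_dim !fctE /component eulerE eqxx mul0r addr0.
  rewrite hatE_lin row_funE -/u.
  rewrite (eq_bigr (fun k => hat x 0 (lp k) * row_fun (M + M^T) (lp k) x
     + hat x 0 (lq k) * row_fun (M + M^T) (lq k) x)); first by ring.
  by move=> k _; rewrite !fctE /component !eulerE !dim_eqE !dq !row_funE !hatE_lin.
rewrite contact_fieldE E2 !dq eulerE starE sgnE.
under eq_bigr do rewrite !dq.
elim/dim_ind: i => [l|l|].
- by rewrite sum_pq_p !dim_eqE starE sgnE /=; ring.
- by rewrite sum_pq_q !dim_eqE starE sgnE /=; ring.
- by rewrite sum_pq_t eqxx starE sgnE /=; ring.
Qed.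

Lemma sp_contactE : sp_contact R n
  = [set projective_field A | A in [set A | symp_adj Jmx A = A]].
Proof.
apply/seteqP; split => Z /=.
  case=> h [/quadratic_of_mpoly [M ->] ->]; rewrite contact_field_quadratic.
  exists ((M + M^T) *m Jmx) => //=.
  rewrite /symp_adj trmx_mul J_anti linearD /= trmxK [M^T + M]addrC.
  by rewrite mulmxA mulmxN J_sqr opprK mul1mx.
(* [theta A = A] means that A J is symmetric; the factor -1/2 gives M + M^T = -A J, and -A J J =
   A. *)
case=> A /= hA <-; pose M := - 2^-1 *: (A *m Jmx).
have [h [h3 hE]] := mpoly_of_quadratic M.
exists h; split=> //; rewrite -hE contact_field_quadratic; congr projective_field.
have MT : (A *m Jmx)^T = A *m Jmx.
  rewrite trmx_mul J_anti mulNmx -{2}hA /symp_adj -!mulmxA J_sqr.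
  by rewrite !mulmxN mulmx1.
have -> : M + M^T = - (A *m Jmx).
  by rewrite /M linearZ /= MT; apply/matrixP => i j; rewrite !mxE; field.
by rewrite mulNmx -mulmxA J_sqr mulmxN mulmx1 opprK.
Qed.

End ContactModel.

(** * The Casimir operator on symbols *)

(** All terms in [rho tau], the quadratic part of the field, fit into the single index [tau]:
    transport contributes - sum x_i dS_i, the fibre action sum y_i eS_i and the divergence -(d+1) W
    S. Together they are [DS tau], which explains the formula for [weight_deriv]. *)
Lemma projective_action_sum (A : comNzRingType) (d : nat)
    (x y dS eS : 'I_d -> A) (S W : A) (a : 'I_(d + 1) -> 'I_(d + 1) -> A)
    (X sg DS iS : 'I_(d + 1) -> A) :
  (forall i, X (lin i) = x i) -> X (tau_idx d) = 1 ->
  (forall i, sg (lin i) = y i) -> sg (tau_idx d) = - \sum_i x i * y i ->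
  (forall i, iS (lin i) = eS i) -> iS (tau_idx d) = 0 ->
  (forall i, DS (lin i) = dS i) ->
  DS (tau_idx d) = \sum_i y i * eS i - \sum_i x i * dS i - (d + 1)%:R * W * S ->
  let rho c := \sum_b a b c * X b in
  \sum_i (rho (lin i) - x i * rho (tau_idx d)) * dS i
  - \sum_i \sum_j (a (lin j) (lin i) - (j == i)%:R * rho (tau_idx d)
                   - x i * a (lin j) (tau_idx d)) * (y i * eS j)
  + W * (\sum_i (a (lin i) (lin i) - rho (tau_idx d) - x i * a (lin i) (tau_idx d))) * S
  = \sum_b \sum_c a b c * (X b * DS c - sg c * iS b + W * (b == c)%:R * S).
Proof.
move=> Xl Xt sl st il it Dl Dt rho.
have E : \sum_b \sum_c a b c * (X b * DS c - sg c * iS b + W * (b == c)%:R * S)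
  = \sum_c rho c * DS c - \sum_b \sum_c a b c * (sg c * iS b) + W * (\sum_b a b b) * S.
  transitivity (\sum_b \sum_c (a b c * X b) * DS c - \sum_b \sum_c a b c * (sg c * iS b)
     + \sum_b \sum_c (if c == b then W * a b b * S else 0)).
    rewrite -sumrB -big_split; apply: eq_bigr => b _ /=.
    rewrite -sumrB -big_split; apply: eq_bigr => c _ /=.
    by rewrite [c == b]eq_sym; case: eqP => [->|_] /=; ring.
  congr (_ - _ + _).
    by rewrite exchange_big; apply: eq_bigr => c _; rewrite /rho mulr_suml.
  rewrite mulr_sumr mulr_suml; apply: eq_bigr => b _.
  by rewrite -big_mkcond big_pred1_eq.
have rhoE : rho (tau_idx d) = \sum_i a (lin i) (tau_idx d) * x i + a (tau_idx d) (tau_idx d).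
  rewrite /rho sum_hat Xt mulr1; congr (_ + _).
  by apply: eq_bigr => i _; rewrite Xl.
have E1 : \sum_i (rho (lin i) - x i * rho (tau_idx d)) * dS i
   = \sum_i rho (lin i) * DS (lin i) - rho (tau_idx d) * \sum_i x i * dS i.
  by rewrite mulr_sumr -sumrB; apply: eq_bigr => i _; rewrite Dl; ring.
have E2 : \sum_i \sum_j (a (lin j) (lin i) - (j == i)%:R * rho (tau_idx d)
                   - x i * a (lin j) (tau_idx d)) * (y i * eS j)
   = \sum_b \sum_c a b c * (sg c * iS b) - rho (tau_idx d) * \sum_i y i * eS i.
  rewrite sum_hat [X in _ + X - _]big1 ?addr0 => [|c _]; last by rewrite it !mulr0.
  rewrite exchange_big mulr_sumr -sumrB; apply: eq_bigr => j _ /=.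
  rewrite sum_hat st il.
  transitivity (\sum_i (a (lin j) (lin i) * (sg (lin i) * eS j)
     - (if i == j then rho (tau_idx d) * (y j * eS j) else 0)
     - a (lin j) (tau_idx d) * eS j * (x i * y i))).
    by apply: eq_bigr => i _; rewrite sl [j == i]eq_sym; case: eqP => [->|_] /=; ring.
  rewrite !sumrB -big_mkcond big_pred1_eq -mulr_sumr; ring.
(* Of the factor d + 1, d comes from the diagonal and 1 from differentiating [rho tau] itself. *)
have E3 : \sum_i (a (lin i) (lin i) - rho (tau_idx d) - x i * a (lin i) (tau_idx d))
   = \sum_b a b b - (d + 1)%:R * rho (tau_idx d).
  rewrite !sumrB sumr_const card_ord sum_hat natrD.
  have -> : \sum_i x i * a (lin i) (tau_idx d) = rho (tau_idx d) - a (tau_idx d) (tau_idx d).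
    by rewrite rhoE addrK; apply: eq_bigr => i _; exact: mulrC.
  by rewrite -[_ *+ d]mulr_natl; ring.
by rewrite E E1 E2 E3 [\sum_c rho c * _]sum_hat Dt; ring.
Qed.

Section Operators.
Variables (R : realType) (d : nat) (w : R).
Local Notation symb := (symbol R d).
Implicit Types (S T : symb) (i j : 'I_d) (a b c : 'I_(d + 1)).

Definition const_symbol (r : R) : symb := mpolyC d (cst r).
Definition coord_symbol i : symb := mpolyC d (coordinate i).
Definition hat_symbol a : symb := mpolyC d (hat_coord a).

Definition symbol_of a : symb :=
  match fintype.split a with
  | inl i => xi R i
  | inr _ => - \sum_i coord_symbol i * xi R i
  end.

Definition fiber_deriv a S : symb :=
  match fintype.split a with inl i => dxi i S | inr _ => 0 end.

(** The weight-zero part is kept apart because it is a derivation; the full operator only satisfies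
    the twisted rule [weight_derivM]. *)
Definition hom_deriv a S : symb :=
  match fintype.split a with
  | inl i => dx i S
  | inr _ => \sum_i xi R i * dxi i S - \sum_i coord_symbol i * dx i S
  end.

Definition weight_deriv a S : symb :=
  hom_deriv a S - (a == tau_idx d)%:R * ((d + 1)%:R * const_symbol w * S).

Lemma symbol_of_lin i : symbol_of (lin i) = xi R i.
Proof. by rewrite /symbol_of split_lshift. Qed.
Lemma symbol_of_last : symbol_of (tau_idx d) = - \sum_i coord_symbol i * xi R i.
Proof. by rewrite /symbol_of split_rshift. Qed.
Lemma fiber_deriv_lin i S : fiber_deriv (lin i) S = dxi i S.
Proof. by rewrite /fiber_deriv split_lshift. Qed.
Lemma fiber_deriv_last S : fiber_deriv (tau_idx d) S = 0.
Proof. by rewrite /fiber_deriv split_rshift. Qed.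
Lemma hom_deriv_lin i S : hom_deriv (lin i) S = dx i S.
Proof. by rewrite /hom_deriv split_lshift. Qed.
Lemma hom_deriv_last S : hom_deriv (tau_idx d) S =
  \sum_i xi R i * dxi i S - \sum_i coord_symbol i * dx i S.
Proof. by rewrite /hom_deriv split_rshift. Qed.
Lemma lin_neq_last i : (lin i == tau_idx d) = false.
Proof. exact: eq_lrshift. Qed.
Lemma hat_symbol_lin i : hat_symbol (lin i) = coord_symbol i.
Proof. by rewrite /hat_symbol hat_coord_lin. Qed.
Lemma hat_symbol_last : hat_symbol (tau_idx d) = 1.
Proof. by rewrite /hat_symbol hat_coord_last; exact: mpolyC1. Qed.

Lemma lin_last_ind (Q : 'I_(d + 1) -> Prop) :
  (forall i, Q (lin i)) -> Q (tau_idx d) -> forall a, Q a.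
Proof.
move=> hl ht a; case: (split_ordP a) => [i|i] ->; first exact: hl.
by rewrite (ord1 i).
Qed.

Lemma weight_deriv_lin i S : weight_deriv (lin i) S = dx i S.
Proof. by rewrite /weight_deriv lin_neq_last mul0r subr0 hom_deriv_lin. Qed.
Lemma weight_deriv_last S : weight_deriv (tau_idx d) S =
  \sum_i xi R i * dxi i S - \sum_i coord_symbol i * dx i S
  - (d + 1)%:R * const_symbol w * S.
Proof. by rewrite /weight_deriv eqxx mul1r hom_deriv_last. Qed.

Local Notation L := (gl_op hat_symbol symbol_of weight_deriv fiber_deriv (const_symbol w)).

Lemma mpolyC_row_fun (A : 'M[R]_(d + 1)) c : mpolyC d (row_fun A c)
  = \sum_b const_symbol (A b c) * hat_symbol b.
Proof. by rewrite /row_fun raddf_sum; apply: eq_bigr => b _; exact: mpolyCM. Qed.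

Lemma const_symbol_bool (b : bool) : const_symbol b%:R = b%:R.
Proof. by case: b; [exact: mpolyC1|exact: mpolyC0]. Qed.

Lemma lie_derivative_projective (A : 'M[R]_(d + 1)) S :
  lie_derivative w (projective_field A) S
  = \sum_a \sum_b const_symbol (A a b) * L a b S.
Proof.
rewrite -(@projective_action_sum symb d coord_symbol (fun i => xi R i) (fun i => dx i S)
  (fun i => dxi i S) S (const_symbol w) (fun a b => const_symbol (A a b))
  hat_symbol symbol_of (fun a => weight_deriv a S) (fun a => fiber_deriv a S)) /=;
  [|exact: hat_symbol_lin|exact: hat_symbol_last|exact: symbol_of_lin
   |exact: symbol_of_last|by move=> i; exact: fiber_deriv_lin|exact: fiber_deriv_last
   |by move=> i; exact: weight_deriv_lin|exact: weight_deriv_last].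
have pc j i : mpolyC d (partial_deriv j (component (projective_field A) i))
  = const_symbol (A (lin j) (lin i))
    - (j == i)%:R * (\sum_b const_symbol (A b (tau_idx d)) * hat_symbol b)
    - coord_symbol i * const_symbol (A (lin j) (tau_idx d)).
  rewrite partial_component [LHS]mpolyCB [X in X - _]mpolyCB.
  rewrite [X in _ - X - _]mpolyCM [X in _ - _ - X]mpolyCM.
  by rewrite -/(const_symbol (j == i)%:R) const_symbol_bool mpolyC_row_fun.
rewrite /lie_derivative /symbol_apply; congr (_ - _ + _).
- apply: eq_bigr => i _; rewrite -[LHS]mul_mpolyC; congr (_ * _).
  rewrite component_projective [LHS]mpolyCB [X in _ - X]mpolyCM.
  by rewrite !mpolyC_row_fun.
- apply: eq_bigr => i _; apply: eq_bigr => j _.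
  by rewrite -[LHS]mul_mpolyC pc.
rewrite -[LHS]mul_mpolyC; congr (_ * _); rewrite [LHS]mpolyCM; congr (_ * _).
by rewrite raddf_sum /=; apply: eq_bigr => i _; rewrite pc eqxx mul1r.
Qed.

End Operators.

(** * Commutation rules and Euler relations for the operators on symbols *)

Section Relations.
Variables (R : realType) (d : nat) (w : R).
Local Notation symb := (symbol R d).
Implicit Types (S T : symb) (i j : 'I_d) (a b c : 'I_(d + 1)).
Local Notation tau := (tau_idx d).
Local Notation X := (@hat_symbol R d).
Local Notation sg := (@symbol_of R d).
Local Notation ii := (@fiber_deriv R d).
Local Notation H := (@hom_deriv R d).
Local Notation D := (@weight_deriv R d w).

Lemma smooth_symbol_sub S T : smooth_symbol S -> smooth_symbol T -> smooth_symbol (S - T).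
Proof. by move=> SS TS; apply: smooth_symbolD => //; exact: smooth_symbolN. Qed.

Lemma smooth_const_symbol (r : R) : smooth_symbol (const_symbol d r).
Proof. by apply: smooth_symbolC; exact: smooth_cst. Qed.

Lemma smooth_coord_symbol i : smooth_symbol (coord_symbol R i).
Proof. by apply: smooth_symbolC; exact: smooth_coordinate. Qed.

Lemma smooth_hat_symbol a : smooth_symbol (X a).
Proof. by apply: smooth_symbolC; exact: smooth_hat_coord. Qed.

Lemma smooth_symbol_of a : smooth_symbol (sg a).
Proof.
elim/lin_last_ind: a => [i|].
  by rewrite symbol_of_lin; exact: smooth_symbol_xi.
rewrite symbol_of_last; apply: smooth_symbolN; apply: smooth_symbol_sum => i.
by apply: smooth_symbolM; [exact: smooth_coord_symbol|exact: smooth_symbol_xi].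
Qed.

Lemma smooth_fiber_deriv a S : smooth_symbol S -> smooth_symbol (ii a S).
Proof.
move=> SS; elim/lin_last_ind: a => [i|].
  by rewrite fiber_deriv_lin; exact: smooth_symbol_dxi.
by rewrite fiber_deriv_last; exact: smooth_symbol0.
Qed.

Lemma smooth_hom_deriv a S : smooth_symbol S -> smooth_symbol (H a S).
Proof.
move=> SS; elim/lin_last_ind: a => [i|].
  by rewrite hom_deriv_lin; exact: smooth_symbol_dx.
rewrite hom_deriv_last; apply: smooth_symbol_sub; apply: smooth_symbol_sum => i.
  by apply: smooth_symbolM; [exact: smooth_symbol_xi|exact: smooth_symbol_dxi].
by apply: smooth_symbolM; [exact: smooth_coord_symbol|exact: smooth_symbol_dx].
Qed.

Lemma smooth_symbol1 : @smooth_symbol R d 1.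
Proof.
suff -> : (1 : symb) = const_symbol d 1 by exact: smooth_const_symbol.
by rewrite /const_symbol [RHS]mpolyC1.
Qed.

Lemma smooth_symbol_nat k : @smooth_symbol R d k%:R.
Proof.
elim: k => [|k IH]; first exact: smooth_symbol0.
by rewrite mulrSr; apply: smooth_symbolD => //; exact: smooth_symbol1.
Qed.

Lemma smooth_weight_deriv a S : smooth_symbol S -> smooth_symbol (D a S).
Proof.
move=> SS; apply: smooth_symbol_sub; first exact: smooth_hom_deriv.
apply: smooth_symbolM; first exact: smooth_symbol_nat.
apply: smooth_symbolM => //.
by apply: smooth_symbolM; [exact: smooth_symbol_nat|exact: smooth_const_symbol].
Qed.

Lemma dx0 i : dx i (0 : symb) = 0.
Proof.
apply/mpolyP => m; rewrite [LHS]mcoeff_dx !mcoeff0.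
exact: (partial_deriv_cst i 0).
Qed.

Lemma dxN i S : smooth_symbol S -> dx i (- S) = - dx i S.
Proof.
by move=> SS; apply/eqP; rewrite -addr_eq0 -dxD ?addNr ?dx0 //; exact: smooth_symbolN.
Qed.

Lemma dx_sum (I : Type) (r : seq I) (G : I -> symb) i :
  (forall k, smooth_symbol (G k)) ->
  dx i (\sum_(k <- r) G k) = \sum_(k <- r) dx i (G k).
Proof.
move=> GS; elim: r => [|a r IH]; first by rewrite !big_nil dx0.
by rewrite !big_cons dxD ?IH //; exact: smooth_symbol_sum.
Qed.

Lemma dx_coord_symbol i j : dx i (coord_symbol R j) = (i == j)%:R.
Proof.
rewrite /coord_symbol dxC partial_deriv_coordinate.
exact: (const_symbol_bool R d (i == j)).
Qed.

Lemma dx_const_symbol i (r : R) : dx i (const_symbol d r) = 0.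
Proof. by rewrite /const_symbol dxC partial_deriv_cst; exact: mpolyC0. Qed.

Lemma dxi_const i f : dxi i (mpolyC d f : symb) = 0.
Proof. exact: mderivC. Qed.

Lemma dxiM i S T : dxi i (S * T) = dxi i S * T + S * dxi i T.
Proof. exact: mderivM. Qed.

Lemma dxiD i S T : dxi i (S + T) = dxi i S + dxi i T.
Proof. exact: mderivD. Qed.

Lemma dxiN i S : dxi i (- S) = - dxi i S.
Proof. exact: mderivN. Qed.

Lemma dxi0 i : dxi i (0 : symb) = 0.
Proof. exact: mderiv0. Qed.

Lemma dxi_sum (I : Type) (r : seq I) (G : I -> symb) i :
  dxi i (\sum_(k <- r) G k) = \sum_(k <- r) dxi i (G k).
Proof. exact: (raddf_sum (@mderiv _ _ i)). Qed.

Lemma hom_derivD a S T : smooth_symbol S -> smooth_symbol T ->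
  H a (S + T) = H a S + H a T.
Proof.
move=> SS TS; elim/lin_last_ind: a => [i|]; first by rewrite !hom_deriv_lin dxD.
rewrite !hom_deriv_last addrACA -opprD -!big_split /=.
congr (_ - _); apply: eq_bigr => i _; first by rewrite dxiD mulrDr.
by rewrite dxD // mulrDr.
Qed.

Lemma hom_derivM a S T : smooth_symbol S -> smooth_symbol T ->
  H a (S * T) = H a S * T + S * H a T.
Proof.
move=> SS TS; elim/lin_last_ind: a => [i|]; first by rewrite !hom_deriv_lin dxM.
rewrite !hom_deriv_last mulrBl mulrBr addrACA -opprD.
rewrite !mulr_suml !mulr_sumr -!big_split /=.
congr (_ - _); apply: eq_bigr => i _.
  by rewrite [dxi i (S * T)]dxiM; move: (dxi i S) (dxi i T) (xi R i) => A B C; ring.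
by rewrite [dx i (S * T)]dxM //; move: (dx i S) (dx i T) (coord_symbol R i) => A B C; ring.
Qed.

Lemma weight_derivM a S T : smooth_symbol S -> smooth_symbol T ->
  D a (S * T) = S * D a T + H a S * T.
Proof.
move=> SS TS; rewrite /weight_deriv [H a (S * T)]hom_derivM //.
by move: (H a S) (H a T) (const_symbol d w) => A B C; ring.
Qed.

Lemma weight_derivD a S T : smooth_symbol S -> smooth_symbol T ->
  D a (S + T) = D a S + D a T.
Proof.
move=> SS TS; rewrite /weight_deriv [H a (S + T)]hom_derivD //.
by move: (H a S) (H a T) (const_symbol d w) => A B C; ring.
Qed.

Lemma hom_deriv_const a (r : R) : H a (const_symbol d r) = 0.
Proof.
elim/lin_last_ind: a => [i|]; first by rewrite hom_deriv_lin dx_const_symbol.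
rewrite hom_deriv_last !big1 ?subrr // => i _; first by rewrite dx_const_symbol mulr0.
by rewrite dxi_const mulr0.
Qed.

Lemma sum_delta_symbol (G : 'I_d -> symb) i :
  \sum_j (i == j)%:R * G j = G i.
Proof.
by rewrite (bigD1 i) //= eqxx mul1r big1 ?addr0 // => j; rewrite eq_sym => /negPf ->; rewrite mul0r.
Qed.

Lemma sum_delta_symbolC (G : 'I_d -> symb) i :
  \sum_j (j == i)%:R * G j = G i.
Proof. by under eq_bigr do rewrite eq_sym; exact: sum_delta_symbol. Qed.

Lemma last_neq_lin i : (tau == lin i) = false.
Proof. by rewrite eq_sym lin_neq_last. Qed.

Lemma lin_eq i j : (lin i == lin j) = (i == j).
Proof. exact: (inj_eq (@lshift_inj _ _)). Qed.

Definition idx_eqE := (lin_neq_last, last_neq_lin, lin_eq, eqxx).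

Lemma hom_deriv_hat b a : H b (X a) = (a == b)%:R - (b == tau)%:R * X a.
Proof.
elim/lin_last_ind: b => [i|]; elim/lin_last_ind: a => [j|].
- by rewrite hom_deriv_lin hat_symbol_lin dx_coord_symbol !idx_eqE mul0r subr0 eq_sym.
- by rewrite hom_deriv_lin hat_symbol_last -(mpolyC1 d) !idx_eqE mul0r subr0
    [dx _ _]dx_const_symbol.
- rewrite hom_deriv_last hat_symbol_lin !idx_eqE mul1r.
  rewrite [X in X - _]big1 => [|i _]; last by rewrite dxi_const mulr0.
  congr (_ - _); under eq_bigr do rewrite dx_coord_symbol mulrC.
  by rewrite sum_delta_symbolC.
- rewrite hat_symbol_last -(mpolyC1 d) [H _ _]hom_deriv_const !idx_eqE mul1r.
  by rewrite mpolyC1 subrr.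
Qed.

Lemma deg_symbol_of_last : \sum_i xi R i * dxi i (sg tau) = sg tau.
Proof.
rewrite symbol_of_last -[RHS]sumrN; apply: eq_bigr => i _.
rewrite dxiN dxi_sum.
under eq_bigr do rewrite dxiM dxi_const mul0r add0r dxi_xi mulrC.
by rewrite sum_delta_symbol; ring.
Qed.

Lemma dx_symbol_of_last i : dx i (sg tau) = - xi R i.
Proof.
rewrite symbol_of_last dxN; last first.
  apply: smooth_symbol_sum => j.
  by apply: smooth_symbolM; [exact: smooth_coord_symbol|exact: smooth_symbol_xi].
rewrite dx_sum => [|j]; last first.
  by apply: smooth_symbolM; [exact: smooth_coord_symbol|exact: smooth_symbol_xi].
congr (- _); rewrite -[RHS](sum_delta_symbol (fun j => xi R j)).
apply: eq_bigr => j _; rewrite dxM; [|exact: smooth_coord_symbol|exact: smooth_symbol_xi].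
by rewrite dx_xi dx_coord_symbol mulr0 addr0.
Qed.

Lemma hom_deriv_symbol_of b c :
  H b (sg c) = (b == tau)%:R * sg c - (c == tau)%:R * sg b.
Proof.
elim/lin_last_ind: b => [i|]; elim/lin_last_ind: c => [j|].
- by rewrite hom_deriv_lin symbol_of_lin dx_xi !idx_eqE !mul0r subrr.
- by rewrite hom_deriv_lin dx_symbol_of_last !idx_eqE mul0r mul1r sub0r symbol_of_lin.
- rewrite hom_deriv_last symbol_of_lin !idx_eqE mul1r mul0r subr0.
  rewrite [X in _ - X]big1 ?subr0 => [|i _]; last by rewrite dx_xi mulr0.
  by under eq_bigr do rewrite dxi_xi mulrC; rewrite sum_delta_symbolC.
- rewrite hom_deriv_last deg_symbol_of_last !idx_eqE !mul1r subrr.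
  under eq_bigr do rewrite dx_symbol_of_last mulrN.
  by rewrite sumrN -symbol_of_last subrr.
Qed.

Lemma fiber_derivD a S T : ii a (S + T) = ii a S + ii a T.
Proof.
by elim/lin_last_ind: a => [i|]; rewrite ?fiber_deriv_lin ?fiber_deriv_last ?dxiD ?addr0.
Qed.

Lemma fiber_deriv_scale a f S : ii a (mpolyC d f * S) = mpolyC d f * ii a S.
Proof.
elim/lin_last_ind: a => [i|]; rewrite ?fiber_deriv_lin ?fiber_deriv_last ?mulr0 //.
by rewrite dxiM dxi_const mul0r add0r.
Qed.

Lemma fiber_deriv_symbol_of a b S : ii a (sg b * S)
  = sg b * ii a S + ((a == b)%:R - (b == tau)%:R * X a) * S.
Proof.
elim/lin_last_ind: a => [i|]; last first.
  rewrite !fiber_deriv_last hat_symbol_last [tau == b]eq_sym mulr0 mulr1 subrr mul0r.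
  by rewrite addr0.
rewrite !fiber_deriv_lin dxiM addrC; congr (_ + _ * _).
elim/lin_last_ind: b => [j|]; rewrite !idx_eqE.
  by rewrite symbol_of_lin dxi_xi mul0r subr0.
rewrite symbol_of_last dxiN dxi_sum mul1r sub0r hat_symbol_lin; congr (- _).
under eq_bigr do rewrite dxiM dxi_const mul0r add0r dxi_xi mulrC.
by rewrite sum_delta_symbol.
Qed.

Lemma fiber_derivC a b S : ii a (ii b S) = ii b (ii a S).
Proof.
elim/lin_last_ind: a => [i|]; elim/lin_last_ind: b => [j|];
  rewrite ?fiber_deriv_lin ?fiber_deriv_last ?fiber_deriv_lin ?dxi0 //.
exact: mderiv_comm.
Qed.

Lemma weight_deriv0 b : D b 0 = 0.
Proof.
have h : H b 0 = 0.
  elim/lin_last_ind: b => [i|]; first by rewrite hom_deriv_lin dx0.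
  by rewrite hom_deriv_last !big1 ?subrr // => i _; rewrite ?dxi0 ?dx0 mulr0.
by rewrite /weight_deriv h !mulr0 subrr.
Qed.

(** The correction at [tau] is the commutator of d/dxi_j with the fibre Euler operator. *)
Lemma weight_deriv_fiber b c S : smooth_symbol S ->
  D b (ii c S) = ii c (D b S) - (b == tau)%:R * ii c S.
Proof.
move=> SS; elim/lin_last_ind: c => [j|]; last first.
  by rewrite !fiber_deriv_last weight_deriv0 mulr0 subrr.
rewrite !fiber_deriv_lin; elim/lin_last_ind: b => [i|].
  by rewrite !weight_deriv_lin !idx_eqE mul0r subr0 dx_dxi.
rewrite !weight_deriv_last !idx_eqE mul1r dxiD dxiN [dxi j (_ - _)]dxiD dxiN !dxi_sum.
have E1 : \sum_i dxi j (xi R i * dxi i S) = dxi j S + \sum_i xi R i * dxi i (dxi j S).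
  rewrite -[X in X + _](sum_delta_symbol (fun i => dxi i S)) -big_split.
  apply: eq_bigr => i _ /=; rewrite dxiM dxi_xi; congr (_ + _ * _).
  exact: mderiv_comm.
have E2 : \sum_i dxi j (coord_symbol R i * dx i S) = \sum_i coord_symbol R i * dx i (dxi j S).
  by apply: eq_bigr => i _; rewrite dxiM dxi_const mul0r add0r dx_dxi.
have E3 : dxi j ((d + 1)%:R * const_symbol d w * S)
    = (d + 1)%:R * const_symbol d w * dxi j S.
  rewrite -!mulrA !mulr_natl [LHS](raddfMn (@mderiv _ _ j)) /=; congr (_ *+ _).
  by rewrite [LHS]dxiM dxi_const mul0r add0r.
rewrite E1 E2 E3.
move: (dxi j S) ((d + 1)%:R * const_symbol d w * dxi j S) (\sum_i xi R i * _)
  (\sum_i coord_symbol R i * _).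
by move=> Z K U V; ring.
Qed.

Lemma deg_lin S : \sum_a sg a * ii a S = \sum_i xi R i * dxi i S.
Proof.
rewrite sum_hat fiber_deriv_last mulr0 addr0.
by apply: eq_bigr => i _; rewrite symbol_of_lin fiber_deriv_lin.
Qed.

Lemma sum_hat_symbol_of : \sum_a X a * sg a = 0.
Proof.
rewrite sum_hat hat_symbol_last mul1r symbol_of_last.
under eq_bigr do rewrite hat_symbol_lin symbol_of_lin.
by rewrite subrr.
Qed.

Lemma sum_hat_weight_deriv S : \sum_a X a * D a S =
  \sum_a sg a * ii a S - (d + 1)%:R * const_symbol d w * S.
Proof.
rewrite deg_lin sum_hat hat_symbol_last mul1r weight_deriv_last.
under eq_bigr do rewrite hat_symbol_lin weight_deriv_lin.
move: (\sum_i xi R i * _) (\sum_i coord_symbol R i * _) ((d + 1)%:R * const_symbol d w * S).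
by move=> U V K; ring.
Qed.

Lemma symbol_two_regular S : S + S = 0 -> S = 0.
Proof.
move=> SS; apply/mpolyP => m; rewrite mcoeff0; apply/funext => x.
have : mcoeff m (S + S) x = 0 by rewrite SS mcoeff0.
rewrite [in LHS]mcoeffD fctE -mulr2n => /eqP.
by rewrite mulrn_eq0 /= => /eqP.
Qed.

End Relations.

Lemma euler_mpoly (A : comNzRingType) (n k : nat) (p : mpoly n A) :
  p \is ishomog1 k mdeg ->
  \sum_i mpolyX A (mnm1 i) * mderiv i p = k%:R * p.
Proof.
move=> hp; have E i : mpolyX A (mnm1 i) * mderiv i p
    = \sum_(m <- msupp p) (m i)%:R * (mcoeff m p *: mpolyX A m).
  rewrite {1}[p]mpolyE linear_sum /= mulr_sumr; apply: eq_bigr => m _.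
  rewrite linearZ /= mderivX -!scalerAr -mpolyXD.
  (* For m i = 0 the truncated subtraction of exponents does not undo the multiplication by xi_i,
     but the coefficient m i is then zero. *)
  have [->|m0] := eqVneq (m i) 0%N; first by rewrite mulr0n scale0r mul0r.
  rewrite mulr_natl scaler_nat; congr (_ *: (mpolyX _ _ *+ _)).
  apply/mnmP => j; rewrite mnmDE mnmBE mnm1E.
  by case: eqP => [<-|_] /=; [rewrite subnKC ?lt0n|rewrite subn0].
under eq_bigr do rewrite E.
rewrite exchange_big [in RHS](mpolyE p) mulr_sumr big_seq [RHS]big_seq.
apply: eq_bigr => m mp; rewrite -mulr_suml -natr_sum -mdegE.
by rewrite (dhomog_mf hp mp).
Qed.

Section FinalScalars.
Variables (R : realType) (n k : nat) (delta : R).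
Variables (A : comNzRingType) (f : {rmorphism R -> A}).

(** The two scalar parts add up to 4 c(k, delta), and (2n+4)^-1 2^-1 = 1/(4(n+2)). Here [- Y] stands
    for X applied to [contact_op], and -1/2 is the ratio of i_alpha to [contact_op], so [Y *+ 2]
    becomes 4 X(i_alpha S). *)
Lemma casimir_scalars (S Y : A) :
  let N : A := (cdim n + 1)%:R in let w := f (R_weight n k delta) in
  let lam := k%:R - N * w in
  f (((cdim n + 1) + 2)%:R^-1 * 2^-1) *
    ((lam * (lam + N - 1) + k%:R * (k%:R + N - 1) - N * w ^+ 2) * S
     + (Y *+ 2 + (lam - k%:R + w * (k%:R - lam)) * S))
  = f (n.+2%:R^-1) * (f (casimir_const n k delta) * S + f (- 2^-1) * (- Y)).
Proof.
move=> N w lam.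
have NE : N = f (2 * n.+1%:R).
  rewrite /N -(rmorph_nat f); congr (f _). rewrite !natrD -natr1; ring.
pose r : R := let N := 2 * n.+1%:R in let w := R_weight n k delta in
  let lam := k%:R - N * w in
  lam * (lam + N - 1) + k%:R * (k%:R + N - 1) - N * w ^+ 2
  + (lam - k%:R + w * (k%:R - lam)).
have rE : lam * (lam + N - 1) + k%:R * (k%:R + N - 1) - N * w ^+ 2
  + (lam - k%:R + w * (k%:R - lam)) = f r.
  rewrite /r /lam NE /w !(rmorphD, rmorphN, rmorphM, rmorph1, rmorph_nat, rmorphXn) /=.
  by [].
have n1 : n.+1%:R != 0 :> R by rewrite pnatr_eq0.
have n2 : n.+2%:R != 0 :> R by rewrite pnatr_eq0.
have -> : (cdim n + 1 + 2)%:R^-1 * 2^-1 = 4^-1 * n.+2%:R^-1 :> R.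
  rewrite -invfM -invfM; congr (_^-1).
  by rewrite !natrD -addn2 natrD; ring.
have rc : r = 4 * casimir_const n k delta.
  rewrite /r /casimir_const /R_weight; field.
  by rewrite ?n1 ?pnatr_eq0.
transitivity (f (4^-1 * n.+2%:R^-1) * (f r * S + Y *+ 2)); first by rewrite -rE; ring.
have eY : f (4^-1 * n.+2%:R^-1) * (Y *+ 2) = f n.+2%:R^-1 * (f (- 2^-1) * - Y).
  rewrite mulrN -mulNr -rmorphN opprK -[Y *+ 2]mulr_natl -(rmorph_nat f).
  by rewrite !mulrA -!rmorphM; congr (f _ * _); field; rewrite -natrD pnatr_eq0.
rewrite mulrDr eY [RHS]mulrDr; congr (_ + _).
by rewrite !mulrA -!rmorphM rc; congr (f _ * _); field; rewrite -natrD pnatr_eq0.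
Qed.

End FinalScalars.

Section ConstSymbol.
Variables (R : realType) (d : nat).

Lemma const_symbol_is_zmod_morphism : zmod_morphism (@const_symbol R d).
Proof.
move=> r s; rewrite /const_symbol -[RHS]mpolyCB; congr mpolyC.
Qed.
HB.instance Definition _ := GRing.isZmodMorphism.Build R (symbol R d)
  (@const_symbol R d) const_symbol_is_zmod_morphism.

Lemma const_symbol_is_monoid_morphism : monoid_morphism (@const_symbol R d).
Proof.
split; first exact: mpolyC1.
by move=> r s; rewrite /const_symbol -[RHS]mpolyCM; congr mpolyC.
Qed.
HB.instance Definition _ := GRing.isMonoidMorphism.Build R (symbol R d)
  (@const_symbol R d) const_symbol_is_monoid_morphism.

End ConstSymbol.

Section Casimir.
Variables (R : realType) (n : nat) (w : R).
Local Notation d := (cdim n).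
Local Notation symb := (symbol R d).
Implicit Types (S T : symb) (a b c : 'I_(d + 1)).
Local Notation C := (@const_symbol R d).
Local Notation X := (@hat_symbol R d).
Local Notation sg := (@symbol_of R d).
Local Notation ii := (@fiber_deriv R d).
Local Notation D := (@weight_deriv R d w).
Local Notation s := (fun a => C (sgn R a)).
Local Notation L := (gl_op X sg D ii (C w)).
Local Notation IA := (contact_op (@star n) X s ii).
Local Notation HA := (hamilton_op (@star n) sg s D).
Local Notation N := ((d + 1)%:R : symb).

Lemma weight_deriv_const a (r : R) S : smooth_symbol S -> D a (C r * S) = C r * D a S.
Proof.
move=> SS; rewrite weight_derivM //; last exact: smooth_const_symbol.
by rewrite hom_deriv_const mul0r addr0.
Qed.

Lemma weight_deriv_hat b a S : smooth_symbol S ->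
  D b (X a * S) = X a * D b S + ((a == b)%:R - (b == tau_idx d)%:R * X a) * S.
Proof.
move=> SS; rewrite weight_derivM //; last exact: smooth_hat_symbol.
by rewrite hom_deriv_hat.
Qed.

Lemma weight_deriv_symbol_of b c S : smooth_symbol S -> D b (sg c * S) =
  sg c * D b S + ((b == tau_idx d)%:R * sg c - (c == tau_idx d)%:R * sg b) * S.
Proof.
move=> SS; rewrite weight_derivM //; last exact: smooth_symbol_of.
by rewrite hom_deriv_symbol_of.
Qed.

Lemma sum_hat_weight_derivE S :
  \sum_a X a * D a S = \sum_a sg a * ii a S - #|'I_(d + 1)|%:R * C w * S.
Proof. by rewrite sum_hat_weight_deriv card_ord. Qed.

Lemma sgn_sqr_symbol a : s a * s a = 1.
Proof. by rewrite -[LHS](rmorphM C) sgn_sqr; exact: (rmorph1 C). Qed.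

Lemma sgn_star_symbol a : s (star a) = - s a.
Proof. by rewrite /= sgn_star; exact: (rmorphN C). Qed.

Lemma sgn_t_symbol : s (lin (it n)) = 1.
Proof. by rewrite /= sgn_t; exact: (rmorph1 C). Qed.

Variables (k : nat) (S : symb).
Hypothesis SS : smooth_symbol S.
Hypothesis degS : \sum_a sg a * ii a S = k%:R * S.
Local Notation lam := (k%:R - N * C w : symb).

Lemma gl_casimir_symbol : \sum_a \sum_b L b a (L a b S)
  = (lam * (lam + N - 1) + k%:R * (k%:R + N - 1) - N * C w ^+ 2) * S.
Proof.
have := @sum_gl_casimir symb 'I_(d + 1) (tau_idx d) X sg D ii (C w) (@smooth_symbol R d)
  (@smooth_symbolD R d) (@smooth_symbolM R d) (@smooth_symbolN R d)
  (@smooth_symbol1 R d) (@smooth_hat_symbol R d) (@smooth_symbol_of R d)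
  (@smooth_const_symbol R d w) (@smooth_weight_deriv R d w) (@smooth_fiber_deriv R d)
  (@weight_derivD R d w) (fun a S => @weight_deriv_const a w S)
  weight_deriv_hat weight_deriv_symbol_of (@weight_deriv_fiber R d w)
  (@fiber_derivD R d) (fun a S => fiber_deriv_scale a (cst w) S)
  (fun a b S => fiber_deriv_scale a (hat_coord b) S) (@fiber_deriv_symbol_of R d)
  (@fiber_derivC R d) (@fiber_deriv_last R d) (@hat_symbol_last R d)
  (@sum_hat_symbol_of R d) (fun S _ => sum_hat_weight_derivE S) k S SS degS.
by rewrite card_ord.
Qed.

Lemma dual_casimir_symbol :
  \sum_a \sum_b s a * s b * L (star a) (star b) (L a b S)
  = - ((HA (IA S) + 2%:R * sg (lin (it n)) * IA S) *+ 2
       + (lam - k%:R + C w * (k%:R - lam)) * S).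
Proof.
have := @sum_dual_casimir symb 'I_(d + 1) (@star n) (lin (it n)) (tau_idx d) X sg s D ii
  (C w) (@smooth_symbol R d) (@starK n) (star_last n) sgn_star_symbol sgn_sqr_symbol
  sgn_t_symbol (@symbol_two_regular R d)
  (@smooth_symbolD R d) (@smooth_symbolM R d) (@smooth_symbolN R d)
  (@smooth_symbol1 R d) (@smooth_hat_symbol R d) (@smooth_symbol_of R d)
  (fun a => @smooth_const_symbol R d (sgn R a))
  (@smooth_const_symbol R d w) (@smooth_weight_deriv R d w) (@smooth_fiber_deriv R d)
  (@weight_derivD R d w) (fun a S => @weight_deriv_const a w S)
  (fun a b S => @weight_deriv_const a (sgn R b) S)
  weight_deriv_hat weight_deriv_symbol_of (@weight_deriv_fiber R d w)
  (@fiber_derivD R d) (fun a S => fiber_deriv_scale a (cst w) S)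
  (fun a b S => fiber_deriv_scale a (hat_coord b) S) (@fiber_deriv_symbol_of R d)
  (fun S _ => sum_hat_weight_derivE S) k S SS degS.
by rewrite card_ord.
Qed.

Lemma deg_contact_symbol : \sum_a sg a * ii a (IA S) = C (k%:R - 1) * IA S.
Proof.
rewrite [LHS](@deg_contact symb 'I_(d + 1) (@star n) (tau_idx d) X sg s ii
  (@fiber_derivD R d) (fun a b S => fiber_deriv_scale a (cst (sgn R b)) S)
  (fun a b S => fiber_deriv_scale a (hat_coord b) S) (@fiber_deriv_symbol_of R d)
  (@fiber_derivC R d) (@fiber_deriv_last R d) k S degS).
by rewrite rmorphB rmorph1 rmorph_nat mulrBl mul1r.
Qed.

End Casimir.

(** * Identification of i_alpha and X with the symplectic pairings *)

Section ContactOperators.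
Variables (R : realType) (n : nat) (w : R).
Local Notation d := (cdim n).
Local Notation symb := (symbol R d).
Implicit Types (S T : symb).
Local Notation C := (@const_symbol R d).
Local Notation X := (@hat_symbol R d).
Local Notation sg := (@symbol_of R d).
Local Notation ii := (@fiber_deriv R d).
Local Notation D := (@weight_deriv R d w).
Local Notation s := (fun a => C (sgn R a)).
Local Notation L := (gl_op X sg D ii (C w)).
Local Notation IA := (contact_op (@star n) X s ii).
Local Notation HA := (hamilton_op (@star n) sg s D).

Lemma sum_idx (V : nmodType) (G : 'I_(d + 1) -> V) :
  \sum_a G a = \sum_k (G (lin (ip k)) + G (lin (iq k))) + G (lin (it n)) + G (tau_idx d).
Proof. by rewrite sum_hat sum_dim. Qed.

Lemma contact_opE S : IA S = \sum_k (coord_symbol R (iq k) * dxi (ip k) S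
    - coord_symbol R (ip k) * dxi (iq k) S) + dxi (it n) S.
Proof.
rewrite /contact_op sum_idx fiber_deriv_last mulr0 addr0 !starE !sgnE.
rewrite hat_symbol_last rmorph1 !mul1r fiber_deriv_lin; congr (_ + _).
apply: eq_bigr => k _; rewrite !starE !sgnE rmorphN !rmorph1 mul1r mulN1r mulNr.
by rewrite !hat_symbol_lin !fiber_deriv_lin.
Qed.

Lemma i_alphaE S : i_alpha S = C (- 2^-1) * IA S.
Proof.
rewrite contact_opE rmorphN /i_alpha -[LHS]mul_mpolyC mulNr -mulrN; congr (_ * _).
rewrite [RHS]opprD; congr (_ - _); rewrite -[RHS]sumrN; apply: eq_bigr => k _.
by rewrite [RHS]opprB; congr (_ - _); rewrite -[LHS]mul_mpolyC.
Qed.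

Lemma hamilton_opE T : HA T =
  - \sum_k (xi R (iq k) * dx (ip k) T - xi R (ip k) * dx (iq k) T)
  + xi R (it n) * D (tau_idx d) T - sg (tau_idx d) * dx (it n) T.
Proof.
rewrite /hamilton_op sum_idx !starE !sgnE rmorphN !rmorph1 !mul1r mulN1r mulNr.
rewrite weight_deriv_lin symbol_of_lin; congr (_ + _ - _).
rewrite -[RHS]sumrN; apply: eq_bigr => k _.
rewrite !starE !sgnE rmorphN !rmorph1 mul1r mulN1r mulNr [RHS]opprB.
by rewrite !weight_deriv_lin !symbol_of_lin.
Qed.

(** [HA] is built with the weight w of S, whereas X acts on i_alpha S with the weight w' of that
    tensor. The weight only affects the coefficient of xi_t T, and the second hypothesis matches
    these coefficients. *)
Lemma gen_hamiltonianE (k : nat) (w' r : R) T :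
  \sum_a sg a * ii a T = C r * T ->
  2 * n.+1%:R * w' - k%:R + r = (d + 1)%:R * w - 2 ->
  gen_hamiltonian k w' T = - (HA T + 2%:R * sg (lin (it n)) * T).
Proof.
move=> degT wr; rewrite hamilton_opE weight_deriv_last -deg_lin degT symbol_of_last symbol_of_lin.
have E1 : \sum_i coord_symbol R i * dx i T
    = symbol_apply (@euler R n) T + coord_symbol R (it n) * dx (it n) T.
  have cE i : component (@euler R n) i = if i == it n then 0 else coordinate i.
    by apply/funext => x; rewrite /component eulerE; case: ifP.
  rewrite /symbol_apply !sum_dim cE eqxx scale0r addr0; congr (_ + _).
  apply: eq_bigr => j _; rewrite !cE !dim_eqE.
  by congr (_ + _); exact: mul_mpolyC.
have E2 : \sum_i coord_symbol R i * xi R i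
    = \sum_j (coord_symbol R (ip j) * xi R (ip j) + coord_symbol R (iq j) * xi R (iq j))
      + coord_symbol R (it n) * xi R (it n) by exact: sum_dim.
have E3 : \sum_j (@coordinate R d (ip j) *: xi R (ip j) + @coordinate R d (iq j) *: xi R (iq j))
    = \sum_j (coord_symbol R (ip j) * xi R (ip j) + coord_symbol R (iq j) * xi R (iq j)).
  by apply: eq_bigr => j _; congr (_ + _); rewrite -[LHS]mul_mpolyC.
have E4 : cst (2 * n.+1%:R * w' - k%:R) *: (xi R (it n) * T)
    = ((d + 1)%:R * C w - 2%:R - C r) * (xi R (it n) * T).
  rewrite -[LHS]mul_mpolyC; congr (_ * _); rewrite -[LHS]/(C _).
  have -> : 2 * n.+1%:R * w' - k%:R = (d + 1)%:R * w - 2 - r by rewrite -wr; ring.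
  by rewrite !rmorphB rmorphM !rmorph_nat.
rewrite /gen_hamiltonian E3 E4 E1 E2.
move: (\sum_j (coord_symbol R (ip j) * _ + _)) (\sum_j (xi R (iq j) * _ - _)).
move: (symbol_apply _ _) (dx (it n) T) (C w) (C r) (coord_symbol _ _) (xi R _) => a1 a2 a3 a4 a5 a6 a7 a8.
ring.
Qed.

End ContactOperators.

(** * Expansion of the Casimir operator on the Lie derivatives of the E_ij *)

Section CasimirSum.
Variables (R : realType) (n : nat) (w : R).
Local Notation d := (cdim n).
Local Notation symb := (symbol R d).
Implicit Types (S T : symb) (a b c : 'I_(d + 1)).
Local Notation C := (@const_symbol R d).
Local Notation X := (@hat_symbol R d).
Local Notation sg := (@symbol_of R d).
Local Notation ii := (@fiber_deriv R d).
Local Notation D := (@weight_deriv R d w).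
Local Notation s := (fun a => C (sgn R a)).
Local Notation L := (gl_op X sg D ii (C w)).

Lemma smooth_gl_op a b S : smooth_symbol S -> smooth_symbol (L a b S).
Proof.
move=> SS; apply: smooth_symbolD; first apply: smooth_symbol_sub.
- by apply: smooth_symbolM; [exact: smooth_hat_symbol|exact: smooth_weight_deriv].
- by apply: smooth_symbolM; [exact: smooth_symbol_of|exact: smooth_fiber_deriv].
apply: smooth_symbolM => //; apply: smooth_symbolM; first exact: smooth_const_symbol.
exact: smooth_symbol_nat.
Qed.

Lemma gl_op_linear a b (r : R) S T : smooth_symbol S -> smooth_symbol T ->
  L a b (C r * S + T) = C r * L a b S + L a b T.
Proof.
move=> SS TS; rewrite /gl_op weight_derivD //; last first.
  by apply: smooth_symbolM => //; exact: smooth_const_symbol.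
rewrite weight_deriv_const // fiber_derivD fiber_deriv_scale -/(const_symbol d r).
move: (D b S) (D b T) (ii a S) (ii a T) (C w) (C r) (X a) (sg b).
move=> a1 a2 a3 a4 a5 a6 a7 a8.
ring.
Qed.

Lemma gl_op0 a b : L a b 0 = 0.
Proof.
have S0 := @smooth_symbol0 R d.
have := gl_op_linear a b 1 S0 S0; rewrite rmorph1 !mul1r addr0 => /esym/eqP.
by rewrite addrC -subr_eq0 addrK => /eqP.
Qed.

Lemma gl_op_sum (I : finType) a b (r : I -> R) (F : I -> symb) :
  (forall i, smooth_symbol (F i)) ->
  L a b (\sum_i C (r i) * F i) = \sum_i C (r i) * L a b (F i).
Proof.
move=> FS; rewrite !unlock /=; elim: (index_enum I) => [|i l IH] /=; first exact: gl_op0.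
rewrite gl_op_linear ?IH //; elim: (l) => [|j l' sm] /=; first exact: smooth_symbol0.
apply: smooth_symbolD => //.
by apply: smooth_symbolM => //; exact: smooth_const_symbol.
Qed.

Lemma sum_const_delta (G : 'I_(d + 1) -> 'I_(d + 1) -> symb) a b :
  \sum_i \sum_j C (delta_mx a b i j) * G i j = G a b.
Proof.
rewrite (bigD1 a) //= [X in _ + X]big1 ?addr0 => [|i /negPf ia]; last first.
  by rewrite big1 // => j _; rewrite mxE ia /= rmorph0 mul0r.
rewrite (bigD1 b) //= big1 ?addr0 => [|j /negPf jb].
  by rewrite mxE !eqxx rmorph1 mul1r.
by rewrite mxE jb andbF rmorph0 mul0r.
Qed.

Lemma casimir_gl_op (N : nat) (b bstar : 'I_N -> vector_field R d) S :
  is_basis (sp_contact R n) b -> is_dual_basis (sp_contact R n) b bstar ->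
  smooth_symbol S ->
  casimir w b bstar S = C (((d + 1) + 2)%:R^-1 * 2^-1) *
   (\sum_k \sum_l L l k (L k l S) - \sum_k \sum_l s k * s l * L (star k) (star l) (L k l S)).
Proof.
move=> b_basis b_dual SS.
have inj A : symp_adj (Jmx R n) A = A -> projective_field A = 0 -> A = 0.
  move=> hA /projective_field_eq0; apply; apply: mxtrace_symp hA; exact: J_sqr.
have [B [Bs [hB hBs tensor]]] := dual_basis_tensor (J_anti R n) (J_sqr R n)
  (sp_contactE R n) inj (@bracket_projective R d) b_basis b_dual.
have E (e : 'I_N) : lie_derivative w (b e) (lie_derivative w (bstar e) S)
    = \sum_k \sum_l \sum_i \sum_j C (B e i j * Bs e k l) * L i j (L k l S).
  rewrite hB hBs !lie_derivative_projective.
  rewrite [\sum_a \sum_b C (Bs e a b) * _](pair_bigA _ (fun k l => C (Bs e k l) * L k l S)) /=.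
  rewrite (pair_bigA _ (fun k l => \sum_i \sum_j C (B e i j * Bs e k l) * L i j (L k l S))) /=.
  rewrite [RHS]exchange_big; apply: eq_bigr => i _ /=.
  rewrite [RHS]exchange_big; apply: eq_bigr => j _ /=.
  rewrite gl_op_sum => [|p]; last exact: smooth_gl_op.
  rewrite mulr_sumr; apply: eq_bigr => p _.
  by rewrite rmorphM mulrA.
rewrite /casimir (eq_bigr _ (fun e _ => E e)).
rewrite exchange_big -sumrB mulr_sumr.
apply: eq_bigr => k _; rewrite exchange_big -sumrB mulr_sumr; apply: eq_bigr => l _ /=.
(* The tensor has coefficients P(E_lk)_ij with theta(E_lk) = - s_k s_l E_k'l', which gives one
   composite of Lie derivatives for each half of [P]. *)
transitivity (\sum_i \sum_j C ((d + 1 + 2)%:R^-1 * 2^-1) *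
   (C (delta_mx l k i j) * L i j (L k l S)
    - s k * s l * (C (delta_mx (star k) (star l) i j) * L i j (L k l S)))).
  rewrite exchange_big; apply: eq_bigr => i _ /=.
  rewrite exchange_big; apply: eq_bigr => j _ /=.
  rewrite -mulr_suml -rmorph_sum tensor /symp_proj theta_delta.
  rewrite ![fun_of_matrix (_ *: _) _ _]mxE [fun_of_matrix (_ + _) _ _]mxE
    ![fun_of_matrix (_ *: _) _ _]mxE.
  rewrite mulrA rmorphM -mulrA; congr (_ * _).
  rewrite rmorphD mulrDl; congr (_ + _).
  by rewrite mulNr rmorphN mulNr !rmorphM; congr (- _); ring.
under eq_bigr do rewrite -mulr_sumr sumrB -mulr_sumr.
by rewrite -mulr_sumr sumrB -mulr_sumr !sum_const_delta.
Qed.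

Lemma hamilton_op_scale (r : R) S : smooth_symbol S ->
  hamilton_op (@star n) sg s D (C r * S) = C r * hamilton_op (@star n) sg s D S.
Proof.
move=> SS; rewrite /hamilton_op mulr_sumr; apply: eq_bigr => b _.
by rewrite weight_deriv_const // mulrCA.
Qed.

End CasimirSum.

Theorem theorem5 (R : realType) (n : nat) (n_ge1 : (1 <= n)%N)
    (k : nat) (delta : R) (delta_noncritical : ~ critical n k delta)
    (N : nat) (b bstar : 'I_N -> vector_field R (cdim n))
    (b_basis : is_basis (sp_contact R n) b)
    (bstar_dual : is_dual_basis (sp_contact R n) b bstar)
    (S : symbol R (cdim n)) (S_tensor : is_symbol k S) :
  casimir (R_weight n k delta) b bstar S =
  cst (n.+2%:R^-1) *: (cst (casimir_const n k delta) *: S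
                       + X_R k.-1 delta (i_alpha S)).
Proof.
have [S_hom SS] := S_tensor.
have degS : \sum_a symbol_of R a * fiber_deriv a S = k%:R * S.
  by rewrite deg_lin; exact: euler_mpoly.
rewrite (casimir_gl_op _ b_basis bstar_dual SS).
rewrite (gl_casimir_symbol _ SS degS) (dual_casimir_symbol _ SS degS) opprK.
set IAS := contact_op _ _ _ _ _; set Y := hamilton_op _ _ _ _ _ + _.
have E := casimir_scalars n k delta (@const_symbol R (cdim n)) S Y; cbv zeta in E.
rewrite [LHS]E {E}.
rewrite -[RHS]mul_mpolyC -[X in _ = _ * (X + _)]mul_mpolyC; congr (_ * (_ + _)).
rewrite {}/Y.
have smIA : smooth_symbol IAS.
  rewrite /IAS contact_opE; apply: smooth_symbolD; last exact: smooth_symbol_dxi.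
  apply: smooth_symbol_sum => j; apply: smooth_symbol_sub;
    by apply: smooth_symbolM; [exact: smooth_coord_symbol|exact: smooth_symbol_dxi].
(* The fiber degree k - 1 of [i_alpha S], except for k = 0, where the truncated
   [k.-1] makes [r] differ from k - 1 but [i_alpha S] vanishes. *)
pose r : R := (cdim n + 1)%:R * R_weight n k delta - 2
  - (2 * n.+1%:R * R_weight n k.-1 delta - k.-1%:R).
have degIA : \sum_a symbol_of R a * fiber_deriv a IAS = const_symbol (cdim n) r * IAS.
  rewrite /IAS (deg_contact_symbol degS) -/IAS.
  have [k0|k0] := posnP k; last first.
    have kE : k.-1%:R = k%:R - 1 :> R by rewrite -subn1 natrB.
    congr (const_symbol _ _ * _); rewrite /r /R_weight kE !natrD -!natr1.
    by field; rewrite natr1 pnatr_eq0.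
  have dS0 i : dxi i S = 0.
    apply/mpolyP => m; rewrite [LHS]mcoeff_deriv mcoeff0.
    rewrite (dhomog_nemf_coeff S_hom) ?mul0rn //=.
    by rewrite mdegD mdeg1 addn1 k0.
  suff -> : IAS = 0 by rewrite !mulr0.
  rewrite /IAS contact_opE dS0 addr0 big1 // => j _.
  by rewrite !dS0 !mulr0 subrr.
have degT : \sum_a symbol_of R a * fiber_deriv a (i_alpha S)
    = const_symbol (cdim n) r * i_alpha S.
  rewrite i_alphaE -/IAS [RHS]mulrCA -degIA [RHS]mulr_sumr; apply: eq_bigr => a _.
  by rewrite fiber_deriv_scale mulrCA.
(* [r] is defined by solving the weight condition, which thus holds identically; that it acts as the
   fibre degree is [degT]. *)
rewrite /X_R (gen_hamiltonianE (w := R_weight n k delta) degT); last by rewrite /r; ring.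
rewrite i_alphaE -/IAS hamilton_op_scale // mulrN; congr (- _).
by rewrite mulrDr; congr (_ + _); rewrite mulrCA.
Qed.
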